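(* Assume $d_I<d_H$. SLINK-SEQ is exponentially consistent: there exists $\alpha>0$ (independent of $C$) such that, as $C\to\infty$, $$\mathbb{E}[N]\le\frac{-\log P_e(C)}{\alpha}\,(1+o(1)),$$ where $N=N(C)$ is the stopping time and $P_e(C)=\mathbb{P}\big[\{C_1(N),\dots,C_K(N)\}\neq\{P_1,\dots,P_K\}\big]$ is the error probability of SLINK-SEQ with parameter $C$.
   Context: Setting: $M\ge2$ mutually independent data sequences; sequence $i$ consists of i.i.d. samples $X^{(i)}_1,X^{(i)}_2,\dots$ from an unknown distribution $p_i$ on $\mathcal X$; $\{1,\dots,M\}$ is partitioned into $K\ge2$ nonempty true clusters $P_1,\dots,P_K$ ($K$ known). $k$ is a measurable positive-definite kernel with $0\le k\le\mathbb{G}$, $\mathcal F$ the unit ball of its RKHS, $d(p,q)=\sup_{f\in\mathcal F}(\mathbb{E}_pf-\mathbb{E}_qf)$ (MMD), $d(i,j)=d(p_i,p_j)$. Estimate: $\hat d(i,j,n)=\Big[\frac1{n^2}\sum_{l,m=1}^n\big(k(X^{(i)}_l,X^{(i)}_m)+k(X^{(j)}_l,X^{(j)}_m)-2k(X^{(i)}_l,X^{(j)}_m)\big)\Big]^{1/2}$. $d_H=\min_{k\neq l}\min_{i\in P_k,j\in P_l}d(i,j)$; $d_I(P_k)=\max\min_{i\in P_{1k},j\in P_{2k}}d(i,j)$ over partitions of $P_k$ into two nonempty disjoint sets (taken as $0$ if $|P_k|=1$); $d_I=\max_kd_I(P_k)$. SLINK with target number $K$ on dissimilarities $\delta$: start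 from singletons, repeatedly merge two current clusters $A\ne B$ minimizing $\min_{i\in A,j\in B}\delta(i,j)$ (ties arbitrary) until $K$ clusters remain. SLINK-SEQ with parameter $C>0$: at each time $n\ge2$ (one new sample of every sequence per time step), run SLINK with target $K$ on $\{\hat d(i,j,n)\}$ to get clusters $C_1(n),\dots,C_K(n)$, and compute $\Gamma_n=\min_{k\neq l}\min_{i\in C_k(n),j\in C_l(n)}\hat d(i,j,n)$; the stopping time is $N=\inf\{n\ge2:\Gamma_n\ge C/\sqrt n\}$ and the output is $\{C_1(N),\dots,C_K(N)\}$. *)

(* Defs.v *)
From HB Require Import structures.
From mathcomp Require Import all_boot all_order all_algebra.
From mathcomp Require Import all_classical all_reals all_analysis.

Set Implicit Arguments.
Unset Strict Implicit.
Unset Printing Implicit Defensive.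

Import Order.TTheory GRing.Theory Num.Theory.
Import numFieldNormedType.Exports.
Local Open Scope classical_set_scope.
Local Open Scope ring_scope.

Section Defs.
Context {R : realType}.

Definition pos_def_kernel {T : Type} (k : T -> T -> R) : Prop :=
  (forall x y, k x y = k y x) /\
  (forall (n : nat) (x : 'I_n -> T) (c : 'I_n -> R),
      0 <= \sum_(a < n) \sum_(b < n) c a * c b * k (x a) (x b)).

(** Unit ball of the RKHS of k (Aronszajn characterisation:
    f is in H_k with ||f||_{H_k} <= 1 iff k - f (x) f is positive semidefinite). *)
Definition rkhs_unit_ball {T : Type} (k : T -> T -> R) : set (T -> R) :=
  [set f | forall (n : nat) (x : 'I_n -> T) (c : 'I_n -> R),
      (\sum_(a < n) c a * f (x a)) ^+ 2
        <= \sum_(a < n) \sum_(b < n) c a * c b * k (x a) (x b)].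

Definition mmd {dT} {T : measurableType dT} (k : T -> T -> R)
    (p q : probability T R) : R :=
  sup [set fine (\int[p]_x (f x)%:E) - fine (\int[q]_x (f x)%:E)
      | f in rkhs_unit_ball k].

Definition mutually_independent {dO dT} {Omega : measurableType dO}
    {T : measurableType dT} {I : eqType} (P : probability Omega R)
    (X : I -> Omega -> T) : Prop :=
  forall (s : seq I) (B : I -> set T),
    uniq s -> (forall i, measurable (B i)) ->
    fine (P (\bigcap_(i in [set` s]) (X i @^-1` B i)))
      = \prod_(i <- s) fine (P (X i @^-1` B i)).

(** The MMD estimate \hat d(i,j,n) from samples 0..n-1 of each sequence
    (the paper's samples 1..n). *)
Definition dhat {Omega T : Type} {M : nat} (k : T -> T -> R)
    (X : 'I_M -> nat -> Omega -> T) (i j : 'I_M) (n : nat) (w : Omega) : R :=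
  Num.sqrt ((n%:R ^+ 2)^-1 *
    \sum_(l < n) \sum_(m < n)
       (k (X i l w) (X i m w) + k (X j l w) (X j m w)
        - 2 * k (X i l w) (X j m w))).

Definition linkage {M : nat} (delta : 'I_M -> 'I_M -> R) (A B : {set 'I_M}) : R :=
  inf [set delta i j | i in [set i | i \in A] & j in [set j | j \in B]].

Definition slink_step {M : nat} (delta : 'I_M -> 'I_M -> R)
    (Q Q' : {set {set 'I_M}}) : Prop :=
  exists A B, [/\ A \in Q, B \in Q, A != B,
    (forall A' B', A' \in Q -> B' \in Q -> A' != B' ->
        linkage delta A B <= linkage delta A' B') &
    Q' = (((Q :\ A) :\ B) :|: [set A :|: B])%SET].

Inductive slink_reach {M : nat} (delta : 'I_M -> 'I_M -> R) (K : nat)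
  : {set {set 'I_M}} -> Prop :=
| slink_init : slink_reach delta K ([set [set i] | i : 'I_M])%SET
| slink_next Q Q' : slink_reach delta K Q -> (K < #|Q|)%N ->
    slink_step delta Q Q' -> slink_reach delta K Q'.

(** Q is a possible output of SLINK with target K (for some tie-breaking). *)
Definition slink_output {M : nat} (delta : 'I_M -> 'I_M -> R) (K : nat)
    (Q : {set {set 'I_M}}) : Prop :=
  slink_reach delta K Q /\ #|Q| = K.

Definition inter_min {M : nat} (delta : 'I_M -> 'I_M -> R)
    (Q : {set {set 'I_M}}) : R :=
  inf [set r | exists i j A B,
        [/\ A \in Q, B \in Q, A != B, i \in A & j \in B] /\ r = delta i j].

Definition d_H {M : nat} (d : 'I_M -> 'I_M -> R) (Ptrue : {set {set 'I_M}}) : R :=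
  inter_min d Ptrue.

Definition d_I_block {M : nat} (d : 'I_M -> 'I_M -> R) (B : {set 'I_M}) : R :=
  if (#|B| <= 1)%N then 0 else
  sup [set linkage d B1 (B :\: B1) | B1 in
       [set B1 : {set 'I_M} | [/\ B1 \subset B, (0 < #|B1|)%N & (0 < #|B :\: B1|)%N]]].

Definition d_I {M : nat} (d : 'I_M -> 'I_M -> R) (Ptrue : {set {set 'I_M}}) : R :=
  \big[Num.max/0]_(B in Ptrue) d_I_block d B.

(** Stopping time N = inf {n >= 2 : Gamma_n >= C / sqrt n}, +oo if empty,
    where cl n w is the SLINK output at time n. *)
Definition stop_cond {Omega T : Type} {M : nat} (k : T -> T -> R)
    (X : 'I_M -> nat -> Omega -> T) (cl : nat -> Omega -> {set {set 'I_M}})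
    (C : R) (n : nat) (w : Omega) : Prop :=
  (2 <= n)%N /\ C / Num.sqrt n%:R <= inter_min (fun i j => dhat k X i j n w) (cl n w).

Definition stop_time {Omega T : Type} {M : nat} (k : T -> T -> R)
    (X : 'I_M -> nat -> Omega -> T) (cl : nat -> Omega -> {set {set 'I_M}})
    (C : R) (w : Omega) : \bar R :=
  match pselect (exists n, stop_cond k X cl C n w) with
  | left h => ((ex_minn (P := fun n => `[< stop_cond k X cl C n w >])
                 (let: ex_intro n hn := h in ex_intro _ n (asboolT hn)))%:R)%:E
  | right _ => +oo%E
  end.

Definition error_event {Omega T : Type} {M : nat} (k : T -> T -> R)
    (X : 'I_M -> nat -> Omega -> T) (cl : nat -> Omega -> {set {set 'I_M}})
    (C : R) (Ptrue : {set {set 'I_M}}) : set Omega :=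
  [set w | ~ exists n, stop_time k X cl C w = (n%:R)%:E /\ cl n w = Ptrue].

End Defs.

(* Main.v *)
Require Import Defs.
From mathcomp Require Import all_boot all_order all_algebra.
From mathcomp Require Import all_classical all_reals all_analysis.
From mathcomp Require Import measurable_realfun ring lra zify.
Set Implicit Arguments.
Unset Strict Implicit.
Unset Printing Implicit Defensive.
Import Order.TTheory GRing.Theory Num.Theory.
Import numFieldNormedType.Exports.
Local Open Scope classical_set_scope.
Local Open Scope ring_scope.

(** Let [d] be the true dissimilarity, [dhat] its estimate and [eta := (d_H - d_I) / 4].  If [dhat]
    is [eta]-close to [d] at time [n], every merge of SLINK before [K] clusters are left joins two
    parts of one true cluster, so that SLINK is correct and [Gamma_n >= d_H - eta].

    The squared estimate is a V-statistic with bounded kernel.  The pairs [(l, m)] with [l + m]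
    fixed involve disjoint indices, so Hoeffding's inequality bounds the sum over each antidiagonal,
    and the probability that [dhat] is not [eta]-close to [d] decays like [expR (- c * n)].
    That the mean of the V-statistic is the squared MMD amounts to positive definiteness of
    [\int \int k dp dq] as a kernel on probability measures; it is obtained by sampling.

    As [dhat <= r], there is no stop before [n = C ^+ 2 / r ^+ 2], whence [P_e] is at most a
    constant times [expR (- c * C ^+ 2 / r ^+ 2)].  As every close time
    [n >= C ^+ 2 / (d_H - eta) ^+ 2] is a stop, [E N] is at most [C ^+ 2 / (d_H - eta) ^+ 2] plus a
    constant.  The exponent [alpha] is the ratio of the two rates. *)

(** * Single linkage on approximate dissimilarities *)

Section Partition.
Context {T : finType}.
Implicit Types (Q Pi : {set {set T}}) (A B : {set T}).

Lemma partition_setTP Q : reflect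
  [/\ finset.set0 \notin Q,
      forall x, exists2 A, A \in Q & x \in A &
      forall x A B, A \in Q -> B \in Q -> x \in A -> x \in B -> A = B]
  (finset.partition Q [set: T]%SET).
Proof.
apply: (iffP and3P) => [[/eqP cQ tQ Q0]|[Q0 cQ uQ]].
  split=> // [x|x A B QA QB xA xB].
    have : x \in finset.cover Q by rewrite cQ finset.in_setT.
    by move=> /finset.bigcupP[A QA xA]; exists A.
  by rewrite -(def_pblock tQ QA xA) -(def_pblock tQ QB xB).
split=> //.
  apply/eqP/finset.setP => x; rewrite finset.in_setT; apply/finset.bigcupP.
  by have [A QA xA] := cQ x; exists A.
apply/finset.trivIsetP => A B QA QB; rewrite -finset.setI_eq0; apply: contraNT.
by move=> /set0Pn[x]; rewrite finset.in_setI => /andP[xA xB]; exact/eqP/(uQ x).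
Qed.

Lemma partition_block_neq0 Q A :
  finset.partition Q [set: T]%SET -> A \in Q -> A != finset.set0.
Proof. by move=> /partition_setTP[Q0 _ _] QA; apply: contraNneq Q0 => <-. Qed.

Lemma partition_singletons :
  finset.partition [set [set i] | i : T]%SET [set: T]%SET.
Proof.
apply/partition_setTP; split.
- by apply/imsetP => -[x _ /esym/eqP]; apply/negP/finset.set0Pn; exists x; rewrite inE.
- by move=> x; exists [set x]%SET; [exact: imset_f|rewrite inE].
- by move=> x _ _ /imsetP[y _ ->] /imsetP[z _ ->]; rewrite !inE => /eqP<- /eqP<-.
Qed.

Definition merge Q A B : {set {set T}} := ((Q :\ A) :\ B) :|: [set A :|: B]%SET.

Lemma mergeP Q A B D : reflect ([/\ D \in Q, D != A & D != B] \/ D = A :|: B)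
  (D \in merge Q A B).
Proof.
rewrite !inE; apply: (iffP orP) => [[/and3P[]|/eqP]|[[-> -> ->]|->]].
- by left.
- by right.
- by left.
- by right.
Qed.

Lemma partition_merge Q A B : finset.partition Q [set: T]%SET ->
  A \in Q -> B \in Q -> finset.partition (merge Q A B) [set: T]%SET.
Proof.
move=> Qpart QA QB; have /partition_setTP[Q0 cQ uQ] := Qpart.
have disjointAB D x : D \in Q -> D != A -> D != B -> x \in D -> x \notin A :|: B.
  move=> QD DA DB xD; rewrite finset.in_setU negb_or; apply/andP; split.
    by apply: contra DA => xA; apply/eqP/(uQ x).
  by apply: contra DB => xB; apply/eqP/(uQ x).
apply/partition_setTP; split.
- apply/mergeP => -[[]|/esym/eqP]; first by rewrite (negbTE Q0).
  by rewrite finset.setU_eq0 (negbTE (partition_block_neq0 Qpart QA)).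
- move=> x; have [D QD xD] := cQ x.
  have [DA|DA] := eqVneq D A.
    by exists (A :|: B); [apply/mergeP; right|rewrite inE -DA xD].
  have [DB|DB] := eqVneq D B.
    by exists (A :|: B); [apply/mergeP; right|rewrite inE -DB xD orbT].
  by exists D => //; apply/mergeP; left.
- move=> x D E /mergeP[[QD DA DB]|->] /mergeP[[QE EA EB]|->]// xD xE.
  + exact: (uQ x).
  + by have := disjointAB D x QD DA DB xD; rewrite xE.
  + by have := disjointAB E x QE EA EB xE; rewrite xD.
Qed.

Definition refines Q Pi := forall A, A \in Q -> exists2 B, B \in Pi & A \subset B.

Lemma refines_singletons Pi : finset.partition Pi [set: T]%SET ->
  refines [set [set i] | i : T]%SET Pi.
Proof.
move=> /partition_setTP[_ cP _] _ /imsetP[x _ ->].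
by have [B PB xB] := cP x; exists B; rewrite // finset.sub1set.
Qed.

Lemma refines_merge Q Pi A B C : refines Q Pi ->
  C \in Pi -> A \subset C -> B \subset C -> refines (merge Q A B) Pi.
Proof.
move=> rQ PC AC BC D /mergeP[[QD _ _]|->]; first exact: rQ.
by exists C; rewrite // finset.subUset AC.
Qed.

Definition block_above Pi A : {set T} :=
  odflt finset.set0 [pick B in Pi | A \subset B].

Lemma block_aboveP Q Pi A : refines Q Pi -> A \in Q ->
  block_above Pi A \in Pi /\ A \subset block_above Pi A.
Proof.
move=> rQ QA; rewrite /block_above; case: pickP => [B /andP[]//|].
by have [B PB AB] := rQ _ QA => /(_ B); rewrite PB AB.
Qed.

Lemma refines_same_card Q Pi :
  finset.partition Q [set: T]%SET -> finset.partition Pi [set: T]%SET ->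
  refines Q Pi -> #|Q| = #|Pi| -> Q = Pi.
Proof.
move=> /partition_setTP[_ cQ _] Ppart rQ cardQ.
have /partition_setTP[_ _ uP] := Ppart.
have aboveP A x : A \in Q -> x \in A -> block_above Pi A \in Pi /\ x \in block_above Pi A.
  move=> QA xA; have [PA AA] := block_aboveP rQ QA.
  by split=> //; exact: (fintype.subsetP AA).
have imQ : (block_above Pi @: Q)%SET = Pi.
  apply/finset.setP => B; apply/imsetP/idP => [[A QA ->]|PB].
    by have [] := block_aboveP rQ QA.
  have /set0Pn[x xB] := partition_block_neq0 Ppart PB.
  have [A QA xA] := cQ x; exists A => //.
  by have [PA xA'] := aboveP A x QA xA; exact: (uP x).
have /imset_injP inj : #|(block_above Pi @: Q)%SET| == #|Q| by rewrite imQ cardQ.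
have fixQ A : A \in Q -> block_above Pi A = A.
  move=> QA; have [PA AA] := block_aboveP rQ QA.
  apply/eqP; rewrite finset.eqEsubset AA andbT; apply/fintype.subsetP => x xA.
  have [B QB xB] := cQ x; have [PB xB'] := aboveP B x QB xB.
  by rewrite (inj A B) //; exact: (uP x).
by rewrite -[LHS]finset.imset_id -[RHS]imQ; apply: eq_in_imset => A /fixQ ->.
Qed.

Lemma refines_pigeonhole Q Pi : refines Q Pi -> (#|Pi| < #|Q|)%N ->
  exists A B C, [/\ A \in Q, B \in Q, A != B & [/\ C \in Pi, A \subset C & B \subset C]].
Proof.
move=> rQ cardQ; have : ~~ dinjectiveb (block_above Pi) (mem Q).
  apply/negP => /dinjectiveP /card_in_imset; apply/eqP; rewrite neq_ltn.
  suff /subset_leq_card im_le : (block_above Pi @: Q)%SET \subset Pi.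
    by rewrite (leq_ltn_trans im_le cardQ).
  by apply/fintype.subsetP => _ /imsetP[D QD ->]; have [] := block_aboveP rQ QD.
move=> /dinjectivePn[A QA [B /andP[AB QB] eqAB]].
have [PA AA] := block_aboveP rQ QA; have [_ BB] := block_aboveP rQ QB.
by exists A, B, (block_above Pi A); split; rewrite // 1?eq_sym//; split; rewrite // eqAB.
Qed.

End Partition.

Section Slink.
Context {R : realType} {M : nat}.
Implicit Types (Q Pi : {set {set 'I_M}}) (d delta : 'I_M -> 'I_M -> R).

Lemma inter_min_le d Pi A B i j : (forall i j, 0 <= d i j) ->
  A \in Pi -> B \in Pi -> A != B -> i \in A -> j \in B -> inter_min d Pi <= d i j.
Proof.
move=> d0 PA PB AB iA jB; apply: ge_inf; last by exists i, j, A, B.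
by exists 0 => _ [i' [j' [? [? [_ ->]]]]].
Qed.

Lemma inter_min_ge d Pi c : finset.partition Pi [set: 'I_M]%SET -> (1 < #|Pi|)%N ->
  (forall A B i j, A \in Pi -> B \in Pi -> A != B -> i \in A -> j \in B ->
    c <= d i j) -> c <= inter_min d Pi.
Proof.
move=> Ppart /card_gt1P[A [B [PA PB AB]]] cd; apply: lb_le_inf; last first.
  by move=> _ [i' [j' [A' [B' [[? ? ? ? ?] ->]]]]]; exact: (cd A' B').
have /set0Pn[x xA] := partition_block_neq0 Ppart PA.
have /set0Pn[y yB] := partition_block_neq0 Ppart PB.
by exists (d x y), x, y, A, B.
Qed.

Lemma linkage_le delta (A B : {set 'I_M}) i j : (forall i j, 0 <= delta i j) ->
  i \in A -> j \in B -> linkage delta A B <= delta i j.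
Proof.
move=> d0 iA jB; apply: ge_inf; last by exists i => //; exists j.
by exists 0 => _ [i' _ [j' _ <-]].
Qed.

Lemma linkage_lt delta (A B : {set 'I_M}) c : A != finset.set0 -> B != finset.set0 ->
  linkage delta A B < c -> exists i j, [/\ i \in A, j \in B & delta i j < c].
Proof.
move=> /set0Pn[x xA] /set0Pn[y yB] /inf_lt[].
  by exists (delta x y), x => //; exists y.
by move=> _ [i iA [j jB <-]] dc; exists i, j.
Qed.

Lemma d_I_ge0 d Pi : 0 <= d_I d Pi.
Proof. by rewrite /d_I bigmax_idl le_max lexx. Qed.

Lemma linkage_le_d_I d Pi (A B : {set 'I_M}) : (forall i j, 0 <= d i j) ->
  B \in Pi -> A \subset B -> A != finset.set0 -> B :\: A != finset.set0 ->
  linkage d A (B :\: A) <= d_I d Pi.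
Proof.
move=> d0 PB AB A0 BA0.
apply: le_trans (@le_bigmax_cond _ _ _ 0 B (mem Pi) (d_I_block d) PB).
have cA : (0 < #|A|)%N by rewrite card_gt0.
have cBA : (0 < #|B :\: A|)%N by rewrite card_gt0.
have cB : (1 < #|B|)%N by rewrite -(cardsID A B) (finset.setIidPr AB); lia.
rewrite /d_I_block leqNgt cB /=; apply: ub_le_sup; last by exists A.
exists (\sum_i \sum_j d i j) => _ [B1 [_ + +] <-].
rewrite !card_gt0 => /set0Pn[i iB] /set0Pn[j jB].
apply: le_trans (linkage_le d0 iB jB) _.
by rewrite (bigD1 i)//= (bigD1 j)//= -addrA lerDl addr_ge0 ?sumr_ge0// => *; exact: sumr_ge0.
Qed.

Variables (d delta : 'I_M -> 'I_M -> R) (Pi : {set {set 'I_M}}) (eta : R).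
Hypothesis Pi_part : finset.partition Pi [set: 'I_M]%SET.
Hypothesis d_ge0 : forall i j, 0 <= d i j.
Hypothesis delta_ge0 : forall i j, 0 <= delta i j.
Hypothesis delta_close : forall i j, i != j -> `|delta i j - d i j| < eta.

Lemma estimate_ge_across_blocks A B i j : A \in Pi -> B \in Pi -> A != B ->
  i \in A -> j \in B -> d_H d Pi - eta <= delta i j.
Proof.
move=> PA PB AB iA jB; have /partition_setTP[_ _ uP] := Pi_part.
have /delta_close : i != j.
  by apply: contraNneq AB => ij; apply/eqP/(uP i) => //; rewrite ij.
have := inter_min_le d_ge0 PA PB AB iA jB.
by rewrite /d_H ltr_norml => ? /andP[]; lra.
Qed.

Lemma inter_min_close : (1 < #|Pi|)%N -> d_H d Pi - eta <= inter_min delta Pi.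
Proof. by move=> P1; apply: inter_min_ge => //; exact: estimate_ge_across_blocks. Qed.

Lemma exists_linkage_lt Q : finset.partition Q [set: 'I_M]%SET ->
  refines Q Pi -> (#|Pi| < #|Q|)%N ->
  exists A B, [/\ A \in Q, B \in Q, A != B & linkage delta A B < d_I d Pi + 2 * eta].
Proof.
move=> Qpart rQ cardQ; have /partition_setTP[_ cQ uQ] := Qpart.
have [A [B [C [QA QB AB [PC AC BC]]]]] := refines_pigeonhole rQ cardQ.
have A0 := partition_block_neq0 Qpart QA.
have /set0Pn[y yB] := partition_block_neq0 Qpart QB.
have yA : y \notin A by apply: contra AB => yA; apply/eqP/(uQ y).
have CA0 : C :\: A != finset.set0.
  by apply/set0Pn; exists y; rewrite finset.in_setD yA (fintype.subsetP BC).
have eta0 : 0 < eta.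
  have /set0Pn[x xA] := A0; apply: le_lt_trans (normr_ge0 _) (@delta_close x y _).
  by apply: contraNneq yA => <-.
have [i [j [iA]]] : exists i j, [/\ i \in A, j \in C :\: A & d i j < d_I d Pi + eta].
  apply: linkage_lt => //.
  by apply: le_lt_trans (linkage_le_d_I d_ge0 PC AC A0 CA0) _; rewrite ltrDl.
rewrite finset.in_setD => /andP[jA _] dij.
have [D QD jD] := cQ j; exists A, D; split=> //; first by apply: contraNneq jA => ->.
apply: le_lt_trans (linkage_le delta_ge0 iA jD) _.
have /delta_close : i != j by apply: contraNneq jA => <-.
by rewrite ltr_norml => /andP[_]; lra.
Qed.

Hypothesis separated : d_I d Pi + 3 * eta < d_H d Pi.

Lemma small_linkage_same_block Q A B : finset.partition Q [set: 'I_M]%SET ->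
  refines Q Pi -> A \in Q -> B \in Q -> linkage delta A B < d_I d Pi + 2 * eta ->
  exists C, [/\ C \in Pi, A \subset C & B \subset C].
Proof.
move=> Qpart rQ QA QB linkAB.
have [PA AA] := block_aboveP rQ QA; have [PB BB] := block_aboveP rQ QB.
have [eqAB|neAB] := eqVneq (block_above Pi A) (block_above Pi B).
  by exists (block_above Pi A); split; rewrite // eqAB.
have neQ := partition_block_neq0 Qpart.
have [i [j [iA jB]]] := linkage_lt (neQ _ QA) (neQ _ QB) linkAB.
have iA' := fintype.subsetP AA _ iA; have jB' := fintype.subsetP BB _ jB.
by have := estimate_ge_across_blocks PA PB neAB iA' jB'; move: separated; lra.
Qed.

Lemma slink_step_refines Q Q' : finset.partition Q [set: 'I_M]%SET ->
  refines Q Pi -> (#|Pi| < #|Q|)%N -> slink_step delta Q Q' ->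
  finset.partition Q' [set: 'I_M]%SET /\ refines Q' Pi.
Proof.
move=> Qpart rQ cardQ [A [B [QA QB AB minAB ->]]]; rewrite -/(merge Q A B).
have [A' [B' [QA' QB' AB' linkAB']]] := exists_linkage_lt Qpart rQ cardQ.
have linkAB := le_lt_trans (minAB _ _ QA' QB' AB') linkAB'.
have [C [PC AC BC]] := small_linkage_same_block Qpart rQ QA QB linkAB.
by split; [exact: partition_merge|exact: refines_merge PC AC BC].
Qed.

Lemma slink_output_correct Q : slink_output delta #|Pi| Q -> Q = Pi.
Proof.
move=> [reachQ cardQ].
suff [Qpart rQ] : finset.partition Q [set: 'I_M]%SET /\ refines Q Pi.
  exact: refines_same_card.
elim: reachQ {cardQ} => [|Q1 Q2 _ [Qpart rQ] cardQ]; last exact: slink_step_refines.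
by split; [exact: partition_singletons|exact: refines_singletons].
Qed.

End Slink.

(** * Bounded measurable functions *)

Section BoundedMeasurable.
Context {R : realType}.

Definition bounded_mfun {d} {T : measurableType d} (f : T -> R) :=
  measurable_fun setT f /\ exists B, forall x, `|f x| <= B.

Section Closure.
Context {d} {T : measurableType d}.
Implicit Types f g : T -> R.

Lemma bounded_mfun_cst (c : R) : bounded_mfun (fun _ : T => c).
Proof. by split; [exact: measurable_cst|exists `|c|]. Qed.

Lemma bounded_mfunD f g : bounded_mfun f -> bounded_mfun g ->
  bounded_mfun (fun x => f x + g x).
Proof.
move=> [mf [B fB]] [mg [C gC]]; split; first exact: measurable_funD.
by exists (B + C) => x; rewrite (le_trans (ler_normD _ _))// lerD.
Qed.

Lemma bounded_mfunB f g : bounded_mfun f -> bounded_mfun g ->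
  bounded_mfun (fun x => f x - g x).
Proof.
move=> [mf [B fB]] [mg [C gC]]; split; first exact: measurable_funB.
by exists (B + C) => x; rewrite (le_trans (ler_normB _ _))// lerD.
Qed.

Lemma bounded_mfunM f g : bounded_mfun f -> bounded_mfun g ->
  bounded_mfun (fun x => f x * g x).
Proof.
move=> [mf [B fB]] [mg [C gC]]; split; first exact: measurable_funM.
by exists (B * C) => x; rewrite normrM ler_pM.
Qed.

Lemma bounded_mfunZ (c : R) f : bounded_mfun f -> bounded_mfun (fun x => c * f x).
Proof. by move=> bf; apply: bounded_mfunM => //; exact: bounded_mfun_cst. Qed.

Lemma bounded_mfun_sum {I : Type} (s : seq I) (F : I -> T -> R) :
  (forall i, bounded_mfun (F i)) -> bounded_mfun (fun x => \sum_(i <- s) F i x).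
Proof.
move=> bF; split; first by apply: measurable_sum => i; case: (bF i).
have [B FB] := choice (fun i => (bF i).2).
exists (\sum_(i <- s) B i) => x.
by apply: le_trans (ler_norm_sum _ _ _) _; exact: ler_sum.
Qed.

Lemma bounded_mfun_comp {d'} {S : measurableType d'} f (u : S -> T) :
  bounded_mfun f -> measurable_fun setT u -> bounded_mfun (fun w => f (u w)).
Proof.
move=> [mf [B fB]] mu; split; first exact: measurableT_comp.
by exists B.
Qed.

End Closure.

Lemma bounded_mfun_comp2 {d1 d2 d} {T1 : measurableType d1} {T2 : measurableType d2}
    {S : measurableType d} (h : T1 -> T2 -> R) (u : S -> T1) (v : S -> T2) :
  bounded_mfun (fun z => h z.1 z.2) -> measurable_fun setT u -> measurable_fun setT v ->
  bounded_mfun (fun w => h (u w) (v w)).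
Proof.
move=> bh mu mv; apply: (bounded_mfun_comp (u := fun w => (u w, v w)) bh).
exact: measurable_fun_pair.
Qed.

Lemma bounded_mfun_integrable {d} {T : measurableType d}
    (mu : {finite_measure set T -> \bar R}) (f : T -> R) :
  bounded_mfun f -> mu.-integrable setT (EFin \o f).
Proof.
move=> [mf [B fB]]; apply: (@le_integrable _ _ _ mu setT measurableT _ (EFin \o cst B)).
- exact/measurable_EFinP.
- by move=> x _ /=; rewrite lee_fin (le_trans (fB x))// ler_norm.
- exact: finite_measure_integrable_cst.
Qed.

Section Rintegral.
Context {d} {T : measurableType d} (P : probability T R).
Implicit Types f g : T -> R.

Lemma EFin_Rintegral f : bounded_mfun f ->
  (\int[P]_x (f x)%:E)%E = (\int[P]_x f x)%:E.
Proof.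
by move=> bf; rewrite fineK//; apply: integrable_fin_num => //; exact: bounded_mfun_integrable.
Qed.

Lemma Rintegral_probability_cst (c : R) : \int[P]_x c = c.
Proof.
rewrite (Rintegral_cst P measurableT) -[RHS]mulr1; congr (_ * _).
exact: (congr1 fine (probability_setT P)).
Qed.

Lemma bounded_RintegralD f g : bounded_mfun f -> bounded_mfun g ->
  \int[P]_x (f x + g x) = \int[P]_x f x + \int[P]_x g x.
Proof. by move=> bf bg; rewrite RintegralD//; exact: bounded_mfun_integrable. Qed.

Lemma bounded_RintegralB f g : bounded_mfun f -> bounded_mfun g ->
  \int[P]_x (f x - g x) = \int[P]_x f x - \int[P]_x g x.
Proof. by move=> bf bg; rewrite RintegralB//; exact: bounded_mfun_integrable. Qed.

Lemma bounded_RintegralZ (c : R) f : bounded_mfun f ->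
  \int[P]_x (c * f x) = c * \int[P]_x f x.
Proof. by move=> bf; rewrite RintegralZl//; exact: bounded_mfun_integrable. Qed.

Lemma bounded_Rintegral_sum {I : Type} (s : seq I) (F : I -> T -> R) :
  (forall i, bounded_mfun (F i)) ->
  \int[P]_x (\sum_(i <- s) F i x) = \sum_(i <- s) \int[P]_x F i x.
Proof.
move=> bF; elim: s => [|i s IH].
  rewrite big_nil; under eq_Rintegral do rewrite big_nil.
  exact: Rintegral_probability_cst.
rewrite big_cons -IH -bounded_RintegralD//; last exact: bounded_mfun_sum.
by apply: eq_Rintegral => x _; rewrite big_cons.
Qed.

Lemma bounded_le_Rintegral f g : bounded_mfun f -> bounded_mfun g ->
  (forall x, f x <= g x) -> \int[P]_x f x <= \int[P]_x g x.
Proof. by move=> bf bg fg; apply: le_Rintegral => //; exact: bounded_mfun_integrable. Qed.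

Lemma norm_Rintegral_le f (B : R) : measurable_fun setT f -> (forall x, `|f x| <= B) ->
  `|\int[P]_x f x| <= B.
Proof.
move=> mf fB; have bf : bounded_mfun f by split=> //; exists B.
apply: le_trans (le_normr_Rintegral measurableT (bounded_mfun_integrable P bf)) _.
rewrite -[leRHS]Rintegral_probability_cst; apply: bounded_le_Rintegral => //.
  by split; [exact: measurableT_comp|exists B => x; rewrite normr_id].
exact: bounded_mfun_cst.
Qed.

End Rintegral.

Section Fubini.
Context {d1 d2} {T1 : measurableType d1} {T2 : measurableType d2}.
Variable h : T1 -> T2 -> R.
Hypothesis bh : bounded_mfun (fun z => h z.1 z.2).
Implicit Types (p : probability T1 R) (q : probability T2 R).

Lemma bounded_mfun_sectionl x : bounded_mfun (h x).
Proof. exact: (bounded_mfun_comp2 (u := fun=> x)). Qed.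

Lemma bounded_mfun_sectionr y : bounded_mfun (h ^~ y).
Proof. exact: (bounded_mfun_comp2 (v := fun=> y)). Qed.

Lemma product_integrable p q : (p \x q)%E.-integrable setT (fun z => (h z.1 z.2)%:E).
Proof.
pose pq : subprobability _ R :=
  product_subprobability (p : subprobability T1 R, q : subprobability T2 R).
exact: (bounded_mfun_integrable pq bh).
Qed.

Lemma Rintegral_prod p q :
  \int[p]_x \int[q]_y h x y = \int[(p \x q)%E]_z h z.1 z.2.
Proof.
rewrite /Rintegral -integral12_prod_meas1; last exact: product_integrable.
congr fine; apply: eq_integral => x _; rewrite /fubini_F/=.
by rewrite (EFin_Rintegral q (bounded_mfun_sectionl x)).
Qed.

Lemma Rintegral_swap p q : \int[p]_x \int[q]_y h x y = \int[q]_y \int[p]_x h x y.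
Proof.
rewrite Rintegral_prod /Rintegral -integral21_prod_meas1; last exact: product_integrable.
congr fine; apply: eq_integral => y _; rewrite /fubini_G/=.
by rewrite (EFin_Rintegral p (bounded_mfun_sectionr y)).
Qed.

Lemma bounded_mfun_Rintegral q : bounded_mfun (fun x => \int[q]_y h x y).
Proof.
have [_ [B hB]] := bh; split; last first.
  exists B => x; apply: norm_Rintegral_le => [|y]; last exact: (hB (x, y)).
  by case: (bounded_mfun_sectionl x).
apply/measurable_EFinP; have := measurable_fubini_F (product_integrable (\d_point) q).
apply: eq_measurable_fun => x _; rewrite /fubini_F/=.
by rewrite (EFin_Rintegral q (bounded_mfun_sectionl x)).
Qed.

End Fubini.

End BoundedMeasurable.

(** * Independence *)

Lemma measurable_preimage {d d'} {T : measurableType d} {T' : measurableType d'}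
    (f : T -> T') (B : set T') :
  measurable_fun setT f -> measurable B -> measurable (f @^-1` B).
Proof. by move=> mf mB; rewrite -[X in measurable X]setTI; exact: mf. Qed.

Lemma measurable_set_ge {R : realType} {d} {T : measurableType d} (f : T -> R) (a : R) :
  measurable_fun setT f -> measurable [set w | a <= f w].
Proof.
move=> mf; rewrite (_ : [set w | _] = f @^-1` `[a, +oo[%classic).
  exact: measurable_preimage.
by apply/seteqP; split => w /=; rewrite in_itv/= andbT.
Qed.

Lemma restriction_eq_g_sigma {R : realType} {d} {T : measurableType d} (P : probability T R)
    (E F : set T) (c : \bar R) (G : set_system T) :
  measurable E -> measurable F -> (0 <= c)%E -> c \is a fin_num ->
  G `<=` measurable -> setI_closed G -> G setT ->
  (forall A, G A -> P (E `&` A) = (c * P (F `&` A))%E) ->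
  forall A, <<s G >> A -> P (E `&` A) = (c * P (F `&` A))%E.
Proof.
move=> mE mF c0 cfin mG GI GT GEF A sGA.
have fc0 : 0 <= fine c by exact: fine_ge0.
pose onE : {measure set T -> \bar R} := mrestr P mE.
pose onF : {measure set T -> \bar R} := mscale (NngNum fc0) (mrestr P mF).
have onEE B : onE B = P (E `&` B) by rewrite setIC.
have onFE B : onF B = (c * P (F `&` B))%E by rewrite -[c in RHS]fineK// setIC.
rewrite -onEE -onFE; apply: (g_sigma_algebra_measure_unique G mG (fun=> setT)) => //.
- by rewrite bigcup_const//; exists 0%N.
- by move=> B GB; rewrite onEE onFE; exact: GEF.
- by move=> _; rewrite onEE setIT ltey_eq fin_num_measure.
Qed.

Section PairLaw.
Context {R : realType} {dO d1 d2 : measure_display} {Omega : measurableType dO}.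
Context {T1 : measurableType d1} {T2 : measurableType d2}.
Variables (P : probability Omega R) (U : Omega -> T1) (V : Omega -> T2).
Hypotheses (mU : measurable_fun setT U) (mV : measurable_fun setT V).
Local Open Scope ereal_scope.

Let mUV : measurable_fun setT (fun w => (U w, V w)).
Proof. exact: measurable_fun_pair. Qed.

Lemma restriction_eq_pair (E F : set Omega) (c : \bar R) :
  measurable E -> measurable F -> 0 <= c -> c \is a fin_num ->
  (forall A B, measurable A -> measurable B ->
     P (E `&` (U @^-1` A `&` V @^-1` B)) = c * P (F `&` (U @^-1` A `&` V @^-1` B))) ->
  forall S, measurable S ->
    P (E `&` (fun w => (U w, V w)) @^-1` S) = c * P (F `&` (fun w => (U w, V w)) @^-1` S).
Proof.
move=> mE mF c0 cfin rectEF S mS; set UV := fun w => (U w, V w).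
pose rect := [set A `*` B | A in @measurable _ T1 & B in @measurable _ T2].
have rectP C : preimage_set_system setT UV rect C ->
    exists A B, [/\ measurable A, measurable B & C = U @^-1` A `&` V @^-1` B].
  by move=> [_ [A mA [B mB <-]] <-]; exists A, B; rewrite setTI.
have rect_preimage A B : measurable A -> measurable B ->
    preimage_set_system setT UV rect (U @^-1` A `&` V @^-1` B).
  by move=> mA mB; exists (A `*` B); [exists A => //; exists B|rewrite setTI].
apply: (restriction_eq_g_sigma mE mF c0 cfin (G := preimage_set_system setT UV rect)).
- move=> _ /rectP[A [B [mA mB ->]]].
  by apply: measurableI; exact: measurable_preimage.
- move=> _ _ /rectP[A [B [mA mB ->]]] /rectP[A' [B' [mA' mB' ->]]].
  rewrite setIACA -(preimage_setI U) -(preimage_setI V).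
  by apply: rect_preimage; exact: measurableI.
- by have := rect_preimage _ _ measurableT measurableT; rewrite !preimage_setT setIT.
- by move=> _ /rectP[A [B [mA mB ->]]]; exact: rectEF.
- rewrite g_sigma_preimageE; exists S; last by rewrite setTI.
  by rewrite measurable_prod_measurableType in mS.
Qed.

Let UV : {mfun Omega >-> (T1 * T2)%type} := mfun_Sub (mem_set mUV).

Variables (p : probability T1 R) (q : probability T2 R).
Hypothesis rect : forall A B, measurable A -> measurable B ->
  P (U @^-1` A `&` V @^-1` B) = p A * q B.

Lemma indep_pair_law S : measurable S -> (p \x q) S = distribution P UV S.
Proof. by apply: product_measure_unique => A B; exact: rect. Qed.

Lemma ge0_integral_indep_pair (h : T1 -> T2 -> R) :
  measurable_fun setT (fun z => h z.1 z.2) -> (forall x y, 0 <= h x y)%R ->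
  \int[P]_w (h (U w) (V w))%:E = \int[p]_x \int[q]_y (h x y)%:E.
Proof.
move=> mh h0.
have -> : \int[P]_w (h (U w) (V w))%:E = \int[distribution P UV]_z (h z.1 z.2)%:E.
  rewrite ge0_integral_distribution//; first exact/measurable_EFinP.
  by move=> z; rewrite lee_fin.
rewrite -(@eq_measure_integral _ _ _ setT _ (p \x q)); last by move=> S mS _; exact: indep_pair_law.
rewrite fubini_tonelli1//; first exact/measurable_EFinP.
by move=> z; rewrite lee_fin.
Qed.

Lemma Rintegral_indep_pair (h : T1 -> T2 -> R) : bounded_mfun (fun z => h z.1 z.2) ->
  (\int[P]_w h (U w) (V w) = \int[p]_x \int[q]_y h x y)%R.
Proof.
move=> bh; have [mh _] := bh; rewrite Rintegral_prod// /Rintegral; congr fine.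
have -> : \int[P]_w (h (U w) (V w))%:E = \int[distribution P UV]_z (h z.1 z.2)%:E.
  rewrite integral_distribution//; first exact/measurable_EFinP.
  exact: (bounded_mfun_integrable P (bounded_mfun_comp2 bh mU mV)).
by apply/esym/eq_measure_integral => S mS _; exact: indep_pair_law.
Qed.

End PairLaw.

Section IndependentFamily.
Context {R : realType} {dO d : measure_display} {Omega : measurableType dO}.
Context {T : measurableType d} {I : choiceType}.
Variables (P : probability Omega R) (X : I -> Omega -> T).
Hypothesis mX : forall i, measurable_fun setT (X i).
Implicit Types (t : seq (I * set T)) (K : seq I) (E : set Omega).
Local Open Scope ereal_scope.

(* A family of events [X i @^-1` B] is encoded by the list of the pairs [(i, B)]. *)
Definition cylinder t := \big[setI/setT]_(q <- t) X q.1 @^-1` q.2.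
Definition marginal_prod t := \prod_(q <- t) P (X q.1 @^-1` q.2).
Definition admissible t := uniq (unzip1 t) /\ {in t, forall q, measurable q.2}.

Definition independent := forall t, admissible t -> P (cylinder t) = marginal_prod t.

Definition indep_event K E := forall t, admissible t -> {subset unzip1 t <= K} ->
  P (E `&` cylinder t) = P E * marginal_prod t.

Lemma admissible_cons i B t : admissible t -> i \notin unzip1 t -> measurable B ->
  admissible ((i, B) :: t).
Proof.
move=> [ut mt] it mB; split=> [|q]; first by rewrite /= it.
by rewrite in_cons => /predU1P[->//|]; exact: mt.
Qed.

Lemma cylinder_cons i B t : cylinder ((i, B) :: t) = X i @^-1` B `&` cylinder t.
Proof. exact: big_cons. Qed.

Lemma marginal_prod_cons i B t : marginal_prod ((i, B) :: t) = P (X i @^-1` B) * marginal_prod t.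
Proof. exact: big_cons. Qed.

Lemma measurable_cylinder t : admissible t -> measurable (cylinder t).
Proof.
move=> [_ mt]; rewrite /cylinder big_seq; apply: bigsetI_measurable => q qt.
exact/measurable_preimage/mt.
Qed.

Lemma marginal_prod_ge0 t : 0 <= marginal_prod t.
Proof. exact: prode_ge0. Qed.

Lemma marginal_prod_fin_num t : admissible t -> marginal_prod t \is a fin_num.
Proof.
move=> [_ mt]; rewrite /marginal_prod big_seq; apply: prode_fin_num => q /mt mq.
by apply: fin_num_measure; exact: measurable_preimage.
Qed.

Lemma independent_indep_event K : independent -> indep_event K setT.
Proof. by move=> indX t admt _; rewrite setTI probability_setT mul1e; exact: indX. Qed.

Lemma admissible_fun t : admissible t -> exists2 B : I -> set T,
  forall i, measurable (B i) & {in t, forall q, B q.1 = q.2}.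
Proof.
move=> [ut mt]; elim: t ut mt => [|[i A] t IH] /= => [_ _|/andP[it ut] mt].
  by exists (fun=> setT).
have [|B mB Bt] := IH ut; first by move=> q qt; apply: mt; rewrite in_cons qt orbT.
exists (fun j => if j == i then A else B j) => [j|q].
  by case: ifP => // _; apply: (mt (i, A)); rewrite mem_head.
rewrite in_cons => /predU1P[->|qt] /=; first by rewrite eqxx.
case: eqP => [qi|_]; last exact: Bt.
by move: it; rewrite -qi map_f.
Qed.

Lemma mutually_independent_independent : mutually_independent P X -> independent.
Proof.
move=> indX t admt; have [ut _] := admt; have [B mB Bt] := admissible_fun admt.
have := indX (unzip1 t) B ut mB.
rewrite bigcap_seq !big_map => PB; rewrite /cylinder /marginal_prod.
rewrite (eq_big_seq (fun q => X q.1 @^-1` B q.1)); last by move=> q /Bt ->.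
rewrite [RHS](eq_big_seq (fun q => P (X q.1 @^-1` B q.1))); last by move=> q /Bt ->.
rewrite -[LHS]fineK; last first.
  by apply: fin_num_measure; apply: bigsetI_measurable => q _; exact: measurable_preimage.
rewrite PB -prodEFin; apply: eq_bigr => q _.
by rewrite fineK//; apply: fin_num_measure; exact: measurable_preimage.
Qed.

Lemma indep_event1 K E i B : indep_event K E -> i \in K -> measurable B ->
  P (E `&` X i @^-1` B) = P E * P (X i @^-1` B).
Proof.
move=> indE iK mB; have := indE [:: (i, B)].
rewrite cylinder_cons marginal_prod_cons /cylinder /marginal_prod !big_nil setIT mule1.
apply; first by apply: admissible_cons.
by move=> j; rewrite inE => /eqP ->.
Qed.

Lemma indep_event_setI K E i A : i \notin K -> measurable A ->
  indep_event (i :: K) E -> indep_event K (E `&` X i @^-1` A).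
Proof.
move=> iK mA indE t admt tK.
rewrite -setIA -cylinder_cons (indep_event1 indE)// ?mem_head// indE.
- by rewrite marginal_prod_cons muleA.
- by apply: admissible_cons => //; apply: contra iK; exact: tK.
- by move=> j; rewrite /= in_cons => /predU1P[->|/tK jK]; rewrite in_cons ?eqxx// jK orbT.
Qed.

Lemma indep_event_preimage_pair {d'} {T' : measurableType d'} (U : Omega -> T')
    K E i : measurable_fun setT U -> measurable E -> i \notin K ->
  (forall A, measurable A -> indep_event (i :: K) (E `&` U @^-1` A)) ->
  forall S, measurable S -> indep_event K (E `&` (fun w => (U w, X i w)) @^-1` S).
Proof.
move=> mU mE iK indU S mS t admt tK.
have it : i \notin unzip1 t by apply: contra iK; exact: tK.
have tK' : {subset unzip1 t <= i :: K} by move=> j /tK; rewrite in_cons => ->; rewrite orbT.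
rewrite setIAC muleC; apply: (restriction_eq_pair mU (mX i)) => //.
- by apply: measurableI => //; exact: measurable_cylinder.
- exact: marginal_prod_ge0.
- exact: marginal_prod_fin_num.
move=> A B mA mB; rewrite setIACA [_ `&` (U @^-1` A `&` _)]setIA.
rewrite (indep_event1 (indU A mA))// ?mem_head//.
have -> : cylinder t `&` X i @^-1` B = cylinder ((i, B) :: t) by rewrite setIC cylinder_cons.
rewrite (indU A mA) ?marginal_prod_cons.
- by rewrite muleA muleC.
- exact: admissible_cons.
- by move=> j; rewrite in_cons => /predU1P[->|/tK']//; exact: mem_head.
Qed.

End IndependentFamily.

Lemma independent_comp {R : realType} {dO d d' : measure_display}
    {Omega : measurableType dO} {T : measurableType d} {T' : measurableType d'}
    {I : choiceType} (P : probability Omega R) (X : I -> Omega -> T) (phi : I -> T -> T') :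
  (forall i, measurable_fun setT (phi i)) -> independent P X ->
  independent P (fun i w => phi i (X i w)).
Proof.
move=> mphi indX t [ut mt].
pose s := [seq (q.1, phi q.1 @^-1` q.2) | q <- t].
have -> : cylinder (fun i w => phi i (X i w)) t = cylinder X s by rewrite /cylinder big_map.
have -> : marginal_prod P (fun i w => phi i (X i w)) t = marginal_prod P X s.
  by rewrite /marginal_prod big_map.
apply: indX; split=> [|_ /mapP[q /mt mq ->]]; last exact: measurable_preimage.
by rewrite /unzip1 -map_comp.
Qed.

Section IndependentPairs.
Context {R : realType} {dO d : measure_display} {Omega : measurableType dO}.
Context {T : measurableType d} {I J : choiceType}.
Variables (P : probability Omega R) (X : I -> Omega -> T) (f g : J -> I).
Hypothesis mX : forall i, measurable_fun setT (X i).
Hypothesis indX : independent P X.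
Hypotheses (injf : injective f) (injg : injective g) (fg : forall j j', f j != g j').
Local Open Scope ereal_scope.

Let pairX j w := (X (f j) w, X (g j) w).
Let pair_keys (r : seq J) := flatten [seq [:: f j; g j] | j <- r].

Lemma indep_event_pair (r : seq J) E j S :
  measurable E -> j \notin r -> measurable S -> indep_event P X (pair_keys (j :: r)) E ->
  P (E `&` pairX j @^-1` S) = P E * P (pairX j @^-1` S) /\
  indep_event P X (pair_keys r) (E `&` pairX j @^-1` S).
Proof.
move=> mE jr mS indE.
have [fK gK] : f j \notin pair_keys r /\ g j \notin pair_keys r.
  split; apply/flatten_mapP => -[l lr]; rewrite !inE.
    by rewrite (negbTE (fg _ _)) orbF => /eqP/injf jl; rewrite jl lr in jr.
  by rewrite eq_sym (negbTE (fg _ _)) => /eqP/injg jl; rewrite jl lr in jr.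
have fgK : f j \notin g j :: pair_keys r by rewrite in_cons negb_or fg.
have mpair : measurable_fun setT (pairX j) by exact: measurable_fun_pair.
split; last first.
  by apply: indep_event_preimage_pair => // A mA; exact: indep_event_setI.
rewrite -[X in _ * P X]setTI; apply: restriction_eq_pair => //.
  exact: fin_num_measure.
move=> A B mA mB; pose t := [:: (f j, A); (g j, B)].
have admt : admissible t.
  by split=> [|q]; rewrite /= !inE ?fg// => /orP[]/eqP->.
have <- : cylinder X t = X (f j) @^-1` A `&` X (g j) @^-1` B.
  by rewrite !cylinder_cons /cylinder big_nil setIT.
by rewrite setTI indX// indE// => l; rewrite !inE => /orP[]/eqP->; rewrite eqxx ?orbT.
Qed.

Lemma independent_pairs : independent P pairX.
Proof.
suff indE t E : admissible t -> measurable E -> indep_event P X (pair_keys (unzip1 t)) E ->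
    P (E `&` cylinder pairX t) = P E * marginal_prod P pairX t.
  move=> t admt; rewrite -[cylinder _ _]setTI indE//.
    by rewrite probability_setT mul1e.
  exact: independent_indep_event.
elim: t E => [|[j S] t IH] E admt mE indE.
  by rewrite /cylinder /marginal_prod !big_nil setIT mule1.
have [/= /andP[jt ut] mt] := admt.
have mS : measurable S by apply: (mt (j, S)); rewrite mem_head.
have [PES indES] := indep_event_pair mE jt mS indE.
rewrite cylinder_cons marginal_prod_cons setIA IH//.
- by rewrite PES muleA.
- by split=> // q qt; apply: mt; rewrite in_cons qt orbT.
- apply: measurableI => //; apply: measurable_preimage => //; exact: measurable_fun_pair.
Qed.

End IndependentPairs.

Lemma ge0_expectation_mul {R : realType} {d : measure_display} {Omega : measurableType d}
    (P : probability Omega R) (U V : Omega -> R) :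
  measurable_fun setT U -> measurable_fun setT V ->
  (forall w, 0 <= U w) -> (forall w, 0 <= V w) ->
  (forall A B, measurable A -> measurable B ->
    P (U @^-1` A `&` V @^-1` B) = (P (U @^-1` A) * P (V @^-1` B))%E) ->
  (\int[P]_w (U w * V w)%:E = \int[P]_w (U w)%:E * \int[P]_w (V w)%:E)%E.
Proof.
move=> mU mV U0 V0 indUV.
pose lawU := distribution P (mfun_Sub (mem_set mU)).
pose lawV := distribution P (mfun_Sub (mem_set mV)).
have mnorm : measurable_fun setT (fun x : R => `|x|) by exact: normr_measurable.
have law_norm (W : {mfun Omega >-> R}) : (forall w, 0 <= W w) ->
    (\int[P]_w (W w)%:E = \int[distribution P W]_x (`|x|%R)%:E)%E.
  move=> W0; rewrite ge0_integral_distribution//; last exact/measurable_EFinP.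
  by apply: eq_integral => w _ /=; rewrite ger0_norm.
have := @ge0_integral_indep_pair _ _ _ _ _ _ _ P U V mU mV lawU lawV indUV
  (fun x y => `|x| * `|y|).
have -> : (\int[P]_w (`|U w| * `|V w|)%:E = \int[P]_w (U w * V w)%:E)%E.
  by apply: eq_integral => w _; rewrite !ger0_norm.
move=> -> //; last first.
  by apply: measurable_funM; apply: measurableT_comp.
under eq_integral => x _.
  under eq_integral => y _ do rewrite EFinM.
  rewrite ge0_integralZl//; last exact/measurable_EFinP.
  over.
rewrite /= ge0_integralZr//; last 2 first.
- exact/measurable_EFinP.
- by apply: integral_ge0 => y _; rewrite lee_fin.
by rewrite -(law_norm (mfun_Sub (mem_set mU)))// -(law_norm (mfun_Sub (mem_set mV))).
Qed.

Lemma ge0_expectation_prod {R : realType} {dO : measure_display} {Omega : measurableType dO}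
    {I : choiceType} (P : probability Omega R) (Y : I -> Omega -> R) (r : seq I) :
  (forall i, measurable_fun setT (Y i)) -> (forall i w, 0 <= Y i w) ->
  independent P Y -> uniq r ->
  (\int[P]_w (\prod_(i <- r) Y i w)%:E = \prod_(i <- r) \int[P]_w (Y i w)%:E)%E.
Proof.
move=> mY Y0 indY ur.
suff prodU (U : Omega -> R) : measurable_fun setT U -> (forall w, 0 <= U w) ->
    (forall A, measurable A -> indep_event P Y r (setT `&` U @^-1` A)) ->
    (\int[P]_w (U w * \prod_(i <- r) Y i w)%:E =
     \int[P]_w (U w)%:E * \prod_(i <- r) \int[P]_w (Y i w)%:E)%E.
  have := prodU (cst 1) (measurable_cst _) (fun=> ler01).
  under eq_integral do rewrite mul1r.
  have -> : (\int[P]_w (cst 1 w)%:E = 1)%E.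
    rewrite -[RHS](probability_setT P) -[RHS]mul1e; exact: (integral_cst P measurableT 1).
  rewrite mul1e.
  apply => A mA; rewrite setTI preimage_cst.
  case: ifP => _; first exact: independent_indep_event.
  by move=> t _ _; rewrite set0I measure0 mul0e.
elim: r ur U => [_|i r IH /= /andP[ir ur]] U mU U0 indU.
  by under eq_integral do rewrite big_nil mulr1; rewrite big_nil mule1.
under eq_integral do rewrite big_cons mulrA.
have mUY : measurable_fun setT (fun w => U w * Y i w) by exact: measurable_funM.
have indUY A : measurable A ->
    indep_event P Y r (setT `&` (fun w => U w * Y i w) @^-1` A).
  move=> mA; have mmul : measurable_fun setT (fun z : R * R => z.1 * z.2).
    by apply: measurable_funM; [exact: measurable_fst|exact: measurable_snd].
  have mA' := measurable_preimage mmul mA.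
  exact: (indep_event_preimage_pair mY mU measurableT ir indU mA').
rewrite (IH ur (fun w => U w * Y i w))//; last by move=> w; exact: mulr_ge0.
rewrite big_cons muleA; congr (_ * _)%E.
apply: ge0_expectation_mul => // A B mA mB.
by have := indep_event1 (indU A mA) (mem_head _ _) mB; rewrite setTI.
Qed.

(** * Exponential decay *)

Section ExpDecay.
Context {R : realType}.
Implicit Types u v : nat -> \bar R.

Definition exp_decay u := exists A c : R,
  [/\ 0 < A, 0 < c & forall n, (u n <= (A * expR (- (c * n%:R)))%:E)%E].

Lemma exp_decay0 : exp_decay (fun=> 0%E).
Proof. by exists 1, 1; split=> // n; rewrite lee_fin mul1r expR_ge0. Qed.

Lemma exp_decay_le u v : (forall n, u n <= v n)%E -> exp_decay v -> exp_decay u.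
Proof.
move=> uv [A [c [A0 c0 vA]]]; exists A, c; split=> // n.
exact: le_trans (uv n) (vA n).
Qed.

Lemma exp_decayD u v : exp_decay u -> exp_decay v -> exp_decay (fun n => u n + v n)%E.
Proof.
move=> [A [c [A0 c0 uA]]] [B [e [B0 e0 vB]]].
exists (A + B), (Num.min c e); split; [exact: addr_gt0|by rewrite lt_min c0|move=> n].
apply: le_trans (leeD (uA n) (vB n)) _; rewrite -EFinD lee_fin mulrDl.
by apply: lerD; rewrite ler_pM2l// ler_expR lerN2 ler_wpM2r// ge_min lexx ?orbT.
Qed.

Lemma exp_decay_sum {I : Type} (s : seq I) (Q : pred I) (u : I -> nat -> \bar R) :
  (forall i, Q i -> exp_decay (u i)) -> exp_decay (fun n => \sum_(i <- s | Q i) u i n)%E.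
Proof.
move=> decay_u; elim: s => [|i s IH].
  by apply: exp_decay_le exp_decay0 => n; rewrite big_nil.
have [Qi|Qi] := boolP (Q i).
  by apply: exp_decay_le (exp_decayD (decay_u i Qi) IH) => n; rewrite big_cons Qi.
by apply: exp_decay_le IH => n; rewrite big_cons (negbTE Qi).
Qed.

Lemma natr_mul_expR_le (c : R) n : 0 < c ->
  n%:R * expR (- (c * n%:R)) <= 2 / c * expR (- (c / 2 * n%:R)).
Proof.
move=> c0; have -> : - (c * n%:R) = - (c / 2 * n%:R) + - (c / 2 * n%:R) :> R by field.
rewrite expRD mulrA ler_wpM2r ?expR_ge0// expRN ler_pdivrMr ?expR_gt0//.
rewrite [leLHS](_ : _ = 2 / c * (c / 2 * n%:R)); last by field; rewrite gt_eqF.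
by rewrite ler_pM2l ?divr_gt0//; apply: le_trans (expR_ge1Dx _); rewrite lerDr.
Qed.

Lemma exp_decay_eventually u (A c : R) n0 : 0 < c -> (forall n, u n <= 1)%E ->
  (forall n, (n0 <= n)%N -> (u n <= (A * (n%:R * expR (- (c * n%:R))))%:E)%E) ->
  exp_decay u.
Proof.
move=> c0 u1 uA; have c20 : 0 < c / 2 by rewrite divr_gt0.
exists (expR (c / 2 * n0%:R) + `|A| * (2 / c)), (c / 2); split=> // [|n].
  by rewrite ltr_pwDl ?expR_gt0// mulr_ge0// divr_ge0// ltW.
rewrite mulrDl; have [n0n|nn0] := leqP n0 n.
  apply: le_trans (uA n n0n) _; rewrite lee_fin ler_wpDl ?mulr_ge0 ?expR_ge0//.
  apply: (@le_trans _ _ (`|A| * (n%:R * expR (- (c * n%:R))))).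
    by rewrite ler_wpM2r ?ler_norm// mulr_ge0// expR_ge0.
  by rewrite -[leRHS]mulrA ler_wpM2l// natr_mul_expR_le.
apply: le_trans (u1 n) _; rewrite lee_fin ler_wpDr ?mulr_ge0 ?expR_ge0 ?invr_ge0 ?(ltW c0)//.
rewrite -expRD -[leLHS]expR0 ler_expR subr_ge0 ler_wpM2l ?(ltW c20)//.
by rewrite ler_nat ltnW.
Qed.

Lemma nneseries_expR (A c : R) (m : nat) : 0 < c ->
  (\sum_(n <oo) (A * expR (- (c * (m + n)%:R)))%:E =
   (A / (1 - expR (- c)) * expR (- (c * m%:R)))%:E)%E.
Proof.
move=> c0; apply/cvg_lim => //.
have -> : (A / (1 - expR (- c)) * expR (- (c * m%:R)) =
    A * expR (- (c * m%:R)) / (1 - expR (- c))) by rewrite mulrAC.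
rewrite (_ : (fun n => _) =
    EFin \o series (geometric (A * expR (- (c * m%:R))) (expR (- c)))).
  apply: cvg_EFin; first by near=> n.
  apply: cvg_geometric_series; rewrite ger0_norm ?expR_ge0// expR_lt1; lra.
apply/funext => n /=; rewrite sumEFin seriesEnat/=; congr EFin.
apply: eq_bigr => i _; rewrite -expRM_natl -mulrA -expRD natrD.
by congr (_ * expR _); ring.
Unshelve. all: by end_near. Qed.

Lemma exp_decay_tail_sum_le u (A c x : R) (m : nat) : 0 < A -> 0 < c -> x <= m%:R ->
  (forall n, 0 <= u n)%E -> (forall n, (u n <= (A * expR (- (c * n%:R)))%:E)%E) ->
  (\sum_(n <oo) u (m + n)%N <= (A / (1 - expR (- c)) * expR (- (c * x)))%:E)%E.
Proof.
move=> A0 c0 xm u0 uA.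
apply: (@le_trans _ _ (\sum_(n <oo) (A * expR (- (c * (m + n)%:R)))%:E)%E).
  by apply: lee_nneseries => // n _.
rewrite nneseries_expR// lee_fin ler_wpM2l ?ler_expR ?lerN2 ?ler_wpM2l ?(ltW c0)//.
by rewrite divr_ge0 ?(ltW A0)// subr_ge0 -expR0 ler_expR oppr_le0 ltW.
Qed.

End ExpDecay.

(** * Hoeffding's inequality *)

Section Hoeffding.
Context {R : realType} {dO : measure_display} {Omega : measurableType dO}.
Variable P : probability Omega R.

Lemma expR_le_quadratic (x : R) : x <= 2^-1 -> expR x <= 1 + x + 2 * x ^+ 2.
Proof.
move=> x2; have x1 : 0 < 1 - x by lra.
have exp_le : expR x * (1 - x) <= 1.
  by rewrite -[leRHS](expRxMexpNx_1 x) ler_pM2l ?expR_gt0// expR_ge1Dx.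
have poly_ge : 1 <= (1 + x + 2 * x ^+ 2) * (1 - x).
  have -> : (1 + x + 2 * x ^+ 2) * (1 - x) = 1 + x ^+ 2 * (1 - 2 * x) by ring.
  by rewrite lerDl mulr_ge0 ?sqr_ge0//; lra.
by rewrite -(ler_pM2r x1); exact: le_trans exp_le poly_ge.
Qed.

Lemma centered_expR_mean_le (Y : Omega -> R) (b : R) : measurable_fun setT Y ->
  (forall w, `|Y w| <= b) -> b <= 2^-1 -> \int[P]_w Y w = 0 ->
  (\int[P]_w (expR (Y w))%:E <= (expR (2 * b ^+ 2))%:E)%E.
Proof.
move=> mY Yb b2 Y0; have bY : bounded_mfun Y by split=> //; exists b.
have Yle w : Y w <= b by exact: le_trans (ler_norm _) (Yb w).
have b0 : 0 <= b by exact: le_trans (normr_ge0 _) (Yb point).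
have bexpY : bounded_mfun (fun w => expR (Y w)).
  split; first exact: measurableT_comp.
  by exists (expR b) => w; rewrite ger0_norm ?expR_ge0// ler_expR.
rewrite EFin_Rintegral// lee_fin.
apply: (@le_trans _ _ (\int[P]_w (1 + 2 * b ^+ 2 + Y w))).
  apply: bounded_le_Rintegral => // [|w].
    by apply: bounded_mfunD => //; exact: bounded_mfun_cst.
  apply: le_trans (expR_le_quadratic (le_trans (Yle w) b2)) _.
  have : Y w ^+ 2 <= b ^+ 2 by rewrite -real_normK ?num_real// lerXn2r ?nnegrE.
  lra.
rewrite bounded_RintegralD//; last exact: bounded_mfun_cst.
by rewrite Y0 addr0 Rintegral_probability_cst expR_ge1Dx.
Qed.

Context {I : choiceType}.
Variables (Y : I -> Omega -> R) (r : seq I) (b : R).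
Hypothesis mY : forall i, measurable_fun setT (Y i).
Hypothesis indY : independent P Y.
Hypothesis ur : uniq r.
Hypothesis b0 : 0 < b.
Hypothesis Yb : forall i w, `|Y i w| <= b.
Hypothesis Y0 : forall i, i \in r -> \int[P]_w Y i w = 0.

Let Ysum w := \sum_(i <- r) Y i w.

Let mYsum : measurable_fun setT Ysum.
Proof. exact: measurable_sum. Qed.

Lemma mmt_gen_fun_sum_le (lam : R) : 0 <= lam -> lam * b <= 2^-1 ->
  ('M_P Ysum lam <= (expR ((size r)%:R * (2 * (lam * b) ^+ 2)))%:E)%E.
Proof.
move=> lam0 lamb; rewrite /mmt_gen_fun unlock.
have mlamY i : measurable_fun setT (fun w => lam * Y i w) by exact: measurable_funM.
have ind_expY : independent P (fun i w => expR (lam * Y i w)).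
  apply: (independent_comp (phi := fun _ x => expR (lam * x))) => // i.
  by apply: measurableT_comp => //; exact: measurable_funM.
have -> : (\int[P]_w ((expR \o lam \o* Ysum) w)%:E =
    \prod_(i <- r) \int[P]_w (expR (lam * Y i w))%:E)%E.
  rewrite -ge0_expectation_prod// => [|i]; last exact: measurableT_comp.
  apply: eq_integral => w _ /=; rewrite mulr_suml expR_sum; congr EFin.
  by apply: eq_bigr => i _; rewrite mulrC.
have mean_le i : i \in r ->
    (\int[P]_w (expR (lam * Y i w))%:E <= (expR (2 * (lam * b) ^+ 2))%:E)%E.
  move=> ir; apply: centered_expR_mean_le => //.
    by move=> w; rewrite normrM ger0_norm// ler_wpM2l.
  by rewrite bounded_RintegralZ ?Y0 ?mulr0//; split=> //; exists b.
rewrite expRM_natl; elim: (r) mean_le => [|i s IH] mean_le; first by rewrite big_nil.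
have mean_ge0 j : (0 <= \int[P]_w (expR (lam * Y j w))%:E)%E.
  by apply: integral_ge0 => w _; rewrite lee_fin expR_ge0.
rewrite big_cons /= exprS EFinM lee_pmul//; first exact: prode_ge0.
  by apply: mean_le; rewrite mem_head.
by apply: IH => j js; apply: mean_le; rewrite in_cons js orbT.
Qed.

Lemma hoeffding (a : R) n : 0 < a -> (size r <= n)%N ->
  (P [set w | (a <= Ysum w)%R] <= (expR (- (a ^+ 2 / (8 * b ^+ 2 * n%:R))))%:E)%E.
Proof.
move=> a0 rn; have Ysum_le w : Ysum w <= n%:R * b.
  apply: (@le_trans _ _ (\sum_(i <- r) b)).
    by apply: ler_sum => i _; exact: le_trans (ler_norm _) (Yb i w).
  by rewrite big_const_seq count_predT iter_addr_0 -[leLHS]mulr_natl ler_wpM2r ?ler_nat// ltW.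
have [a_le|a_gt] := leP a (n%:R * b); last first.
  rewrite (_ : [set w | _] = set0) ?measure0 ?lee_fin ?expR_ge0//.
  by apply/seteqP; split=> // w /= /le_trans/(_ (Ysum_le w)); rewrite leNgt a_gt.
have n0 : 0 < n%:R :> R by rewrite -(pmulr_lgt0 _ b0) (lt_le_trans a0).
pose lam := a / (4 * n%:R * b ^+ 2).
have lam0 : 0 < lam by rewrite divr_gt0// !mulr_gt0// exprn_gt0.
have lamb : lam * b <= 2^-1.
  have -> : lam * b = a / (n%:R * b) / 4 by rewrite /lam; field; rewrite !gt_eqF.
  have : a / (n%:R * b) <= 1 by rewrite ler_pdivrMr ?mulr_gt0// mul1r.
  lra.
have := @chernoff _ _ _ P (mfun_Sub (mem_set mYsum)) lam a lam0; move=> /le_trans; apply.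
apply: (@le_trans _ _ ((expR ((size r)%:R * (2 * (lam * b) ^+ 2)))%:E *
    (expR (- (lam * a)))%:E)%E).
  by rewrite lee_wpmul2r ?lee_fin ?expR_ge0//; apply: mmt_gen_fun_sum_le => //; exact: ltW.
rewrite -EFinM lee_fin -expRD ler_expR.
apply: (@le_trans _ _ (n%:R * (2 * (lam * b) ^+ 2) - lam * a)).
  by rewrite lerD2r ler_wpM2r ?ler_nat// mulr_ge0// sqr_ge0.
by rewrite le_eqVlt; apply/orP; left; apply/eqP; rewrite /lam; field; rewrite !gt_eqF.
Qed.

End Hoeffding.

Lemma hoeffding_abs {R : realType} {dO : measure_display} {Omega : measurableType dO}
    {I : choiceType} (P : probability Omega R) (Y : I -> Omega -> R) (r : seq I) (a b : R) n :
  (forall i, measurable_fun setT (Y i)) -> independent P Y -> uniq r ->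
  0 < b -> (forall i w, `|Y i w| <= b) -> (forall i, i \in r -> \int[P]_w Y i w = 0) ->
  0 < a -> (size r <= n)%N ->
  (P [set w | (a <= `|\sum_(i <- r) Y i w|)%R] <=
    (2 * expR (- (a ^+ 2 / (8 * b ^+ 2 * n%:R))))%:E)%E.
Proof.
move=> mY indY ur b0 Yb Y0 a0 rn.
pose Y' i w := - Y i w.
have mY' i : measurable_fun setT (Y' i) by exact: measurableT_comp.
have indY' : independent P Y'.
  exact: (independent_comp (fun=> @oppr_measurable R setT) indY).
have Y'0 i : i \in r -> \int[P]_w Y' i w = 0.
  move=> ir; rewrite (_ : \int[P]_w _ = \int[P]_w (-1 * Y i w)).
    by rewrite bounded_RintegralZ ?Y0 ?mulr0//; split=> //; exists b.
  by apply: eq_Rintegral => w _; rewrite mulN1r.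
have -> : [set w | a <= `|\sum_(i <- r) Y i w|] =
    [set w | a <= \sum_(i <- r) Y i w] `|` [set w | a <= \sum_(i <- r) Y' i w].
  apply/seteqP; split => w /=; rewrite sumrN.
    by rewrite ler_normr => /orP[]; [left|right].
  by rewrite ler_normr => -[->|->]//; rewrite orbT.
apply: (le_trans (measureU2 _ _ _)).
- by apply: measurable_set_ge; exact: measurable_sum.
- by apply: measurable_set_ge; exact: measurable_sum.
rewrite mulr2n mulrDl mul1r EFinD; apply: leeD; first exact: hoeffding.
by apply: hoeffding => // i w; rewrite normrN.
Qed.

(** * Concentration of V-statistics *)

Lemma sum_square_antidiagonal {V : nmodType} (F : nat -> nat -> V) n :
  \sum_(l < n) \sum_(m < n) F l m = \sum_(l < n) F l l +
  \sum_(s < n.*2) \sum_(l < uphalf s | (s - l < n)%N) (F l (s - l)%N + F (s - l)%N l).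
Proof.
have upper (H : nat -> nat -> V) :
    \sum_(0 <= l < n) \sum_(0 <= m < n | (l < m)%N) H l m =
    \sum_(0 <= s < n.*2) \sum_(0 <= l < uphalf s | (s - l < n)%N) H l (s - l)%N.
  transitivity (\sum_(0 <= s < n.*2)
      \sum_(0 <= l < n | (l.*2 < s)%N && (s - l < n)%N) H l (s - l)%N).
    rewrite [RHS](exchange_big_dep_nat xpredT)//=; apply: eq_big_nat => l ln.
    transitivity (\sum_(0 + l <= s < n + l | (l < s - l)%N) H l (s - l)%N).
      by rewrite big_addn addnK; apply: eq_big => [m|m _]; rewrite addnK.
    rewrite [LHS](@big_nat_widen _ _ _ _ _ n.*2); last lia.
    by rewrite [LHS](@big_nat_widenl _ _ _ _ 0)//; apply: eq_bigl => s; lia.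
  apply: eq_big_nat => s sn; rewrite [RHS](@big_nat_widen _ _ _ _ _ n); last lia.
  by apply: eq_bigl => l; lia.
have lower : \sum_(0 <= l < n) \sum_(0 <= m < n | (m < l)%N) F l m =
    \sum_(0 <= l < n) \sum_(0 <= m < n | (l < m)%N) F m l.
  by rewrite (exchange_big_dep_nat xpredT).
have split_row l : (l < n)%N -> \sum_(0 <= m < n) F l m = F l l +
    (\sum_(0 <= m < n | (l < m)%N) F l m + \sum_(0 <= m < n | (m < l)%N) F l m).
  move=> ln; rewrite (bigD1_seq l) ?mem_index_iota ?iota_uniq//=; congr (_ + _).
  rewrite (bigID (fun m => (l < m)%N))/=; congr (_ + _).
    by apply: eq_bigl => m; lia.
  by apply: eq_bigl => m; lia.
have : \sum_(0 <= l < n) \sum_(0 <= m < n) F l m = \sum_(0 <= l < n) F l l +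
    \sum_(0 <= s < n.*2)
      \sum_(0 <= l < uphalf s | (s - l < n)%N) (F l (s - l)%N + F (s - l)%N l).
  under [X in _ = _ + X]eq_bigr do rewrite big_split.
  rewrite big_split/= -(upper F) -(upper (fun l m => F m l)) -lower -!big_split/=.
  by apply: eq_big_nat => l /andP[_]; exact: split_row.
rewrite !big_mkord; under eq_bigr do rewrite big_mkord.
by under [X in _ = _ + X]eq_bigr do rewrite big_mkord.
Qed.

Section VStatistic.
Context {R : realType} {dO d : measure_display}.
Context {Omega : measurableType dO} {T : measurableType d}.
Variables (P : probability Omega R) (Z : nat -> Omega -> T).
Variables (h : T -> T -> R) (B mu : R).
Hypothesis mZ : forall l, measurable_fun setT (Z l).
Hypothesis indZ : independent P Z.
Hypothesis mh : measurable_fun setT (fun z => h z.1 z.2).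
Hypothesis B0 : 0 < B.
Hypothesis hB : forall x y, `|h x y| <= B.
Hypothesis mean_h : forall l m, l != m -> \int[P]_w h (Z l w) (Z m w) = mu.

Definition vstat_sum n w := \sum_(l < n) \sum_(m < n) h (Z l w) (Z m w).

Let bh : bounded_mfun (fun z => h z.1 z.2).
Proof. by split=> //; exists B => z. Qed.

Lemma bounded_mfun_hZ l m : bounded_mfun (fun w => h (Z l w) (Z m w)).
Proof. exact: bounded_mfun_comp2. Qed.

Lemma measurable_vstat_sum n : measurable_fun setT (vstat_sum n).
Proof.
by apply: measurable_sum => l; apply: measurable_sum => m; case: (bounded_mfun_hZ l m).
Qed.

Lemma norm_mean_le : `|mu| <= B.
Proof.
rewrite -(@mean_h 0 1)//; apply: norm_Rintegral_le => //.
by case: (bounded_mfun_hZ 0 1).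
Qed.

Let centered z := h z.1 z.2 + h z.2 z.1 - 2 * mu.

Let bounded_mfun_centered : bounded_mfun centered.
Proof.
apply: bounded_mfunB; last exact: bounded_mfun_cst.
apply: bounded_mfunD => //.
apply: (bounded_mfun_comp2 (u := snd) (v := fst) bh).
  exact: measurable_snd.
exact: measurable_fst.
Qed.

Let norm_centered_le z : `|centered z| <= 4 * B.
Proof.
have := hB z.1 z.2; have := hB z.2 z.1; have := norm_mean_le.
rewrite /centered !ler_norml => /andP[? ?] /andP[? ?] /andP[? ?].
by apply/andP; split; lra.
Qed.

Let mean_centered l m : l != m -> \int[P]_w centered (Z l w, Z m w) = 0.
Proof.
move=> lm; have bZ := bounded_mfun_hZ.
rewrite bounded_RintegralB; [|by apply: bounded_mfunD; exact: bZ|exact: bounded_mfun_cst].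
rewrite Rintegral_probability_cst /= bounded_RintegralD// !mean_h//; last by rewrite eq_sym.
by ring.
Qed.

Let antidiagonal n s w :=
  \sum_(l < uphalf s | (s - l < n)%N) centered (Z l w, Z (s - l)%N w).

(* The index pairs [{l, s - l}] of one antidiagonal are disjoint, so its terms are independent. *)
Let antidiagonal_deviation n s (a : R) : (s < n.*2)%N -> 0 < a ->
  (P [set w | (a <= `|antidiagonal n s w|)%R] <=
    (2 * expR (- (a ^+ 2 / (8 * (4 * B) ^+ 2 * n%:R))))%:E)%E.
Proof.
move=> sn a0; pose Y (l : 'I_(uphalf s)) w := centered (Z l w, Z (s - l)%N w).
pose r := [seq l : 'I_(uphalf s) <- index_enum _ | (s - l < n)%N].
have mpair l m : measurable_fun setT (fun w => (Z l w, Z m w)) by exact: measurable_fun_pair.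
have indY : independent P Y.
  apply: (independent_comp (phi := fun=> centered)) => [_|].
    by case: bounded_mfun_centered.
  apply: (independent_pairs (f := fun l : 'I_(uphalf s) => l : nat)
    (g := fun l => (s - l)%N)) => //.
  - exact: val_inj.
  - move=> l m /= slm; apply: val_inj => /=.
    by have := ltn_ord l; have := ltn_ord m; lia.
  - move=> l m; have := ltn_ord l; have := ltn_ord m; lia.
have -> : antidiagonal n s = fun w => \sum_(l <- r) Y l w.
  by apply/funext => x; rewrite big_filter.
apply: hoeffding_abs => //.
- by move=> l; apply: measurableT_comp => //; case: bounded_mfun_centered.
- exact: filter_uniq (index_enum_uniq _).
- exact: mulr_gt0.
- by move=> l w; exact: norm_centered_le.
- by move=> l _; apply: mean_centered; have := ltn_ord l; lia.
- rewrite size_filter (leq_trans (count_size _ _))//.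
  by rewrite -sum1_size big_const_ord iter_addn_0 mul1n; lia.
Qed.

Let vstat_sum_close n (eps : R) w : (0 < n)%N -> 4 * B <= eps * n%:R ->
  (forall s, (s < n.*2)%N -> `|antidiagonal n s w| < eps * n%:R / 4) ->
  `|vstat_sum n w - n%:R ^+ 2 * mu| < eps * n%:R ^+ 2.
Proof.
move=> n0 Bn close; pose F l m := h (Z l w) (Z m w) - mu.
have -> : vstat_sum n w - n%:R ^+ 2 * mu = \sum_(l < n) \sum_(m < n) F l m.
  under [RHS]eq_bigr do rewrite sumrB sumr_const card_ord.
  by rewrite sumrB sumr_const card_ord expr2 -mulrA !mulr_natl.
rewrite sum_square_antidiagonal.
have diagonal : `|\sum_(l < n) F l l| <= n%:R * (2 * B).
  apply: le_trans (ler_norm_sum _ _ _) _.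
  rewrite [leRHS]mulr_natl -[X in _ *+ X]card_ord -sumr_const; apply: ler_sum => l _.
  by rewrite (le_trans (ler_normB _ _))// mulr_natl mulr2n lerD// norm_mean_le.
have off_diagonal : `|\sum_(s < n.*2) antidiagonal n s w| < n.*2%:R * (eps * n%:R / 4).
  apply: le_lt_trans (ler_norm_sum _ _ _) _.
  rewrite [ltRHS]mulr_natl -[X in _ *+ X](card_ord n.*2) -sumr_const.
  apply: ltr_sum => [|s _]; last exact: close.
  have n20 : (0 < n.*2)%N by rewrite double_gt0.
  by apply/hasP; exists (Ordinal n20) => //; exact: mem_index_enum.
rewrite [X in _ + X](_ : _ = \sum_(s < n.*2) antidiagonal n s w); last first.
  by apply: eq_bigr => s _; apply: eq_bigr => l _; rewrite /F /centered /=; ring.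
apply: le_lt_trans (ler_normD _ _) _; apply: lt_le_trans (ler_ltD diagonal off_diagonal) _.
have := ler_wpM2l (ler0n R n) Bn; rewrite -addnn natrD expr2; nra.
Qed.

Lemma vstat_sum_deviation n (eps : R) : (0 < n)%N -> 0 < eps -> 4 * B <= eps * n%:R ->
  (P [set w | (eps * n%:R ^+ 2 <= `|vstat_sum n w - n%:R ^+ 2 * mu|)%R] <=
    (4 * (n%:R * expR (- (eps ^+ 2 / (8 * (16 * B) ^+ 2) * n%:R))))%:E)%E.
Proof.
move=> n0 eps0 Bn; have nR0 : 0 < n%:R :> R by rewrite ltr0n.
pose D s := [set w | (eps * n%:R / 4 <= `|antidiagonal n s w|)%R].
have mZZ l m : measurable_fun setT (fun w => centered (Z l w, Z m w)).
  apply: measurableT_comp; first by case: bounded_mfun_centered.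
  exact: measurable_fun_pair.
have mD s : measurable (D s).
  apply: measurable_set_ge; apply: measurableT_comp => //; rewrite /antidiagonal.
  by under eq_fun do rewrite -big_filter; exact: measurable_sum.
apply: (@le_trans _ _ (\sum_(s < n.*2) P (D s))%E).
  apply: content_subadditive => //.
    apply: measurable_set_ge; apply: measurableT_comp => //; apply: measurable_funB => //.
    exact: measurable_vstat_sum.
  move=> w /= far; rewrite -bigcup_mkord; apply: contrapT => noD.
  move: far; rewrite leNgt => /negP; apply; apply: vstat_sum_close => // s sn.
  by rewrite ltNge; apply/negP => Ds; apply: noD; exists s.
pose c := eps ^+ 2 / (8 * (16 * B) ^+ 2).
apply: (@le_trans _ _ (\sum_(s < n.*2) (2 * expR (- (c * n%:R)))%:E)%E).
  apply: lee_sum => s _; have a0 : 0 < eps * n%:R / 4 by rewrite divr_gt0// mulr_gt0.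
  apply: le_trans (antidiagonal_deviation (ltn_ord s) a0) _.
  rewrite lee_fin ler_pM2l// ler_expR lerN2 le_eqVlt; apply/orP; left; apply/eqP.
  by rewrite /c; field; rewrite !gt_eqF.
rewrite sumEFin lee_fin sumr_const card_ord -[leLHS]mulr_natl -addnn natrD.
by rewrite le_eqVlt; apply/orP; left; apply/eqP; rewrite -/c; ring.
Qed.

Lemma vstat_sum_exp_decay (eps : R) : 0 < eps ->
  exp_decay (fun n => P [set w | (eps * n%:R ^+ 2 <= `|vstat_sum n w - n%:R ^+ 2 * mu|)%R]).
Proof.
move=> eps0; pose n0 := (Num.truncn (4 * B / eps)).+1.
apply: (@exp_decay_eventually _ _ 4 (eps ^+ 2 / (8 * (16 * B) ^+ 2)) n0).
- by rewrite divr_gt0 ?exprn_gt0// mulr_gt0// exprn_gt0// mulr_gt0.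
- move=> n; apply: probability_le1; apply: measurable_set_ge; apply: measurableT_comp => //.
  by apply: measurable_funB => //; exact: measurable_vstat_sum.
move=> n n0n; apply: vstat_sum_deviation => //; first exact: leq_trans n0n.
rewrite [leRHS]mulrC -ler_pdivrMr//; apply: le_trans (ltW (truncnS_gt _)) _.
by rewrite ler_nat.
Qed.

End VStatistic.

(** * Positive definite kernels *)

Lemma discriminant_le {R : realFieldType} (a b c : R) : 0 <= c ->
  (forall x, 0 <= a + 2 * (x * b) + x ^+ 2 * c) -> b ^+ 2 <= a * c.
Proof.
move=> c0 nonneg; have [ce0|cn0] := eqVneq c 0.
  have [->|bn0] := eqVneq b 0; first by rewrite expr0n/= ce0 mulr0.
  have := nonneg (- (a + 1) / (2 * b)); rewrite ce0 mulr0 addr0.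
  rewrite [leRHS](_ : _ = -1) ?ler0N1//; by field.
have cp : 0 < c by rewrite lt_def cn0.
have := nonneg (- b / c); rewrite -(pmulr_lge0 _ cp).
have -> : (a + 2 * (- b / c * b) + (- b / c) ^+ 2 * c) * c = a * c - b ^+ 2 by field.
by rewrite subr_ge0.
Qed.

Lemma quadratic_ge0 {R : archiRealFieldType} (a b : R) :
  (forall n : nat, 0 <= n%:R ^+ 2 * a + n%:R * b) -> 0 <= a.
Proof.
move=> nonneg; rewrite leNgt; apply/negP => a0.
pose n := (Num.truncn (b / - a)).+1; have n0 : 0 < n%:R :> R by rewrite ltr0n.
have : b < n%:R * - a by rewrite -ltr_pdivrMr ?oppr_gt0// truncnS_gt.
have := nonneg n; rewrite expr2 -mulrA -mulrDr pmulr_rge0//; lra.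
Qed.

Lemma sum_flatten_nseq {R : pzRingType} {I : Type} (F : I -> R) n (r : seq I) :
  \sum_(i <- flatten (nseq n r)) F i = n%:R * \sum_(i <- r) F i.
Proof. by rewrite big_flatten big_nseq iter_addr_0 mulr_natl. Qed.

Section KernelForm.
Context {R : realType} {T : Type}.
Implicit Types (k : T -> T -> R) (f : T -> R) (s t : seq (R * T)) (u : R * T).

Definition lform f s := \sum_(a <- s) a.1 * f a.2.
Definition qform k s := \sum_(a <- s) a.1 * lform (k a.2) s.

Lemma lform_cons f u s : lform f (u :: s) = u.1 * f u.2 + lform f s.
Proof. exact: big_cons. Qed.

Lemma qform_cons k s u : (forall x y, k x y = k y x) ->
  qform k (u :: s) = qform k s + 2 * (u.1 * lform (k u.2) s) + u.1 ^+ 2 * k u.2 u.2.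
Proof.
move=> ksym; rewrite /qform big_cons lform_cons.
under eq_bigr do rewrite lform_cons mulrDr.
rewrite big_split/= [X in _ + (X + _)](_ : _ = u.1 * lform (k u.2) s); first by ring.
by rewrite mulr_sumr; apply: eq_bigr => a _; rewrite ksym mulrCA.
Qed.

Lemma qform_catCA k s u t : qform k (s ++ u :: t) = qform k (u :: s ++ t).
Proof.
have catCA (F : R * T -> R) :
    \sum_(a <- s ++ u :: t) F a = \sum_(a <- u :: s ++ t) F a.
  by rewrite big_cat !big_cons big_cat/= addrCA.
by rewrite /qform catCA; apply: eq_bigr => a _; rewrite /lform catCA.
Qed.

Lemma exists_ord_weights s : exists n (c : 'I_n -> R) (x : 'I_n -> T),
  s = [seq (c i, x i) | i <- enum 'I_n].
Proof.
exists (size s), (fun i => (tnth (in_tuple s) i).1), (fun i => (tnth (in_tuple s) i).2).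
rewrite -[LHS](map_tnth_enum (in_tuple s)); apply: eq_map => i.
exact: surjective_pairing.
Qed.

Lemma lform_ord f n (c : 'I_n -> R) (x : 'I_n -> T) :
  lform f [seq (c i, x i) | i <- enum 'I_n] = \sum_(i < n) c i * f (x i).
Proof. by rewrite /lform big_map big_enum. Qed.

Lemma qform_ord k n (c : 'I_n -> R) (x : 'I_n -> T) :
  qform k [seq (c i, x i) | i <- enum 'I_n] =
  \sum_(i < n) \sum_(j < n) c i * c j * k (x i) (x j).
Proof.
rewrite /qform big_map big_enum; apply: eq_bigr => i _; rewrite lform_ord mulr_sumr.
by apply: eq_bigr => j _ /=; rewrite mulrA.
Qed.

Lemma pos_def_kernelP k : pos_def_kernel k <->
  (forall x y, k x y = k y x) /\ forall s, 0 <= qform k s.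
Proof.
split=> -[ksym k0]; split=> //; last by move=> n x c; rewrite -qform_ord.
by move=> s; have [n [c [x ->]]] := exists_ord_weights s; rewrite qform_ord.
Qed.

Lemma rkhs_unit_ballP k f :
  rkhs_unit_ball k f <-> forall s, lform f s ^+ 2 <= qform k s.
Proof.
split=> [ballf s|ballf n x c]; last by rewrite -lform_ord -qform_ord.
by have [n [c [x ->]]] := exists_ord_weights s; rewrite lform_ord qform_ord.
Qed.

Lemma pos_def_kernel_sub k f : pos_def_kernel k -> rkhs_unit_ball k f ->
  pos_def_kernel (fun x y => k x y - f x * f y).
Proof.
move=> /pos_def_kernelP[ksym _] /rkhs_unit_ballP ballf; apply/pos_def_kernelP.
split=> [x y|s]; first by rewrite ksym [f x * _]mulrC.
rewrite [qform _ s](_ : _ = qform k s - lform f s ^+ 2) ?subr_ge0//.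
rewrite expr2 [X in _ - X]mulr_suml /qform -sumrB; apply: eq_bigr => a _.
rewrite -mulrA -mulrBr; congr (_ * _); rewrite mulr_sumr -sumrB.
by apply: eq_bigr => b _; ring.
Qed.

Lemma norm_rkhs_unit_ball_le k f x : rkhs_unit_ball k f -> `|f x| <= Num.sqrt (k x x).
Proof.
move=> /rkhs_unit_ballP/(_ [:: (1, x)]); rewrite /qform /lform !big_seq1/= !mul1r.
by rewrite -sqrtr_sqr => /ler_wsqrtr.
Qed.

Lemma qform_flatten_nseq k n s : qform k (flatten (nseq n s)) = n%:R ^+ 2 * qform k s.
Proof.
rewrite /qform sum_flatten_nseq expr2 -mulrA; congr (_ * _); rewrite mulr_sumr.
by apply: eq_bigr => a _; rewrite /lform sum_flatten_nseq mulrCA.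
Qed.

(* The minimization of [qform k s - 2 * lform f s] over [s] is, up to a constant, that of the
   squared norm of [f - \sum_(a <- s) a.1 * k a.2]. *)
Lemma rkhs_unit_ball_approx k f (B : R) : pos_def_kernel k -> 0 <= B ->
  (forall x, k x x <= B) -> rkhs_unit_ball k f ->
  forall e : R, 0 < e -> exists s, forall x, `|f x - lform (k x) s| <= e.
Proof.
move=> /pos_def_kernelP[ksym k0] B0 kB /rkhs_unit_ballP ballf e e0.
pose J s := qform k s - 2 * lform f s.
have J_inf : has_inf (range J).
  split; first by exists (J [::]), [::].
  by exists (-1) => _ [s _ <-]; rewrite /J; have := ballf s; have := sqr_ge0 (lform f s - 1); nra.
pose tau : R := e / (1 + B); have B1 : 0 < 1 + B by rewrite ltr_pwDl.
have tau0 : 0 < tau by rewrite divr_gt0.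
have [_ [s _ <-] Js] := inf_adherent (exprn_gt0 2 tau0) J_inf.
exists s => x; have half (y : R) : 2 * y * (f x - lform (k x) s) <= tau ^+ 2 + y ^+ 2 * B.
  have : inf (range J) <= J ((y, x) :: s) by apply: ge_inf; [case: J_inf|exists ((y, x) :: s)].
  rewrite /J qform_cons// lform_cons /= => Jx.
  have := ler_wpM2l (sqr_ge0 y) (kB x); move: Js; rewrite /J; lra.
have -> : e = tau * (1 + B) by rewrite /tau divfK// gt_eqF.
have := half tau; have := half (- tau); rewrite sqrrN => lower upper.
by rewrite ler_norml; apply/andP; split; rewrite -(ler_pM2l tau0); nra.
Qed.

End KernelForm.

Lemma uniform_limit_measurable {R : realType} {d} {T : measurableType d} (f : T -> R) :
  (forall e : R, 0 < e ->
    exists2 g : T -> R, measurable_fun setT g & forall x, `|f x - g x| <= e) ->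
  measurable_fun setT f.
Proof.
move=> approx; have approx_inv m : exists g : T -> R,
    measurable_fun setT g /\ forall x, `|f x - g x| <= m.+1%:R^-1.
  have inv_gt0 : 0 < m.+1%:R^-1 :> R by rewrite invr_gt0.
  by have [g mg fg] := approx _ inv_gt0; exists g.
have [g gP] := choice approx_inv.
apply: (@measurable_fun_cvg _ _ _ setT g) => [m|x _]; first by have [] := gP m.
apply/cvgrPdist_le => e e0; near=> m.
have [_ /(_ x) fg] := gP m; apply: le_trans fg _; apply: ltW.
by near: m; exact: near_infty_natSinv_lt (PosNum e0).
Unshelve. all: by end_near. Qed.

(** * Mean embeddings and the maximum mean discrepancy *)

Section MeanEmbedding.
Context {R : realType} {d} {T : measurableType d}.
Variable k : T -> T -> R.
Hypothesis bk : bounded_mfun (fun z => k z.1 z.2).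
Hypothesis kpd : pos_def_kernel k.
Implicit Types (p q m : probability T R).

Local Notation point_mass x := (\d_x : probability T R).

Definition mean_kernel p q := \int[p]_x \int[q]_y k x y.

Let ksym x y : k x y = k y x. Proof. by case: kpd. Qed.

Lemma mean_kernelC p q : mean_kernel p q = mean_kernel q p.
Proof.
rewrite /mean_kernel Rintegral_swap//; apply: eq_Rintegral => y _.
by apply: eq_Rintegral => x _.
Qed.

Lemma Rintegral_dirac (f : T -> R) x : measurable_fun setT f -> \int[\d_x]_y f y = f x.
Proof.
move=> mf; rewrite /Rintegral integral_dirac//; last exact/measurable_EFinP.
by rewrite diracT mul1e.
Qed.

Lemma mean_kernel_dirac x q : mean_kernel (point_mass x) q = \int[q]_y k x y.
Proof. by rewrite /mean_kernel Rintegral_dirac//; case: (bounded_mfun_Rintegral bk q). Qed.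

Lemma mean_kernel_dirac2 x y : mean_kernel (point_mass x) (point_mass y) = k x y.
Proof. by rewrite mean_kernel_dirac Rintegral_dirac//; case: (bounded_mfun_sectionl bk x). Qed.

Lemma bounded_mfun_mean_kernel_dirac q : bounded_mfun (fun x => mean_kernel (point_mass x) q).
Proof.
by under eq_fun do rewrite mean_kernel_dirac; exact: bounded_mfun_Rintegral.
Qed.

(* A sample of [m] is paired with itself, which replaces [mean_kernel m m] by the mean of the
   diagonal of [k]. *)
Definition diagonal_excess m := \int[m]_x k x x - mean_kernel m m.

Lemma Rintegral_mean_kernel_dirac m q : \int[m]_x mean_kernel (point_mass x) q = mean_kernel m q.
Proof. by apply: eq_Rintegral => x _; rewrite mean_kernel_dirac. Qed.

Let bounded_mfun_lform_dirac (r : seq (R * probability T R)) :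
  bounded_mfun (fun x => lform (mean_kernel (point_mass x)) r).
Proof.
apply: bounded_mfun_sum => w; apply: bounded_mfunZ.
exact: bounded_mfun_mean_kernel_dirac.
Qed.

Let bounded_mfun_diagonal : bounded_mfun (fun x => k x x).
Proof. exact: (bounded_mfun_comp2 (u := id) (v := id)). Qed.

Let qform_dirac_cons (c : R) x (r : seq (R * probability T R)) :
  qform mean_kernel ((c, point_mass x) :: r) =
  qform mean_kernel r + 2 * (c * lform (mean_kernel (point_mass x)) r) + c ^+ 2 * k x x.
Proof. by rewrite (qform_cons _ _ mean_kernelC) /= mean_kernel_dirac2. Qed.

Lemma bounded_mfun_qform_dirac (c : R) (r : seq (R * probability T R)) :
  bounded_mfun (fun x => qform mean_kernel ((c, point_mass x) :: r)).
Proof.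
under eq_fun do rewrite qform_dirac_cons.
apply: bounded_mfunD; last exact: bounded_mfunZ.
by apply: bounded_mfunD; [exact: bounded_mfun_cst|do 2!apply: bounded_mfunZ].
Qed.

Lemma Rintegral_qform_dirac m (c : R) (r : seq (R * probability T R)) :
  \int[m]_x qform mean_kernel ((c, point_mass x) :: r) =
  qform mean_kernel ((c, m) :: r) + c ^+ 2 * diagonal_excess m.
Proof.
under eq_Rintegral do rewrite qform_dirac_cons.
have blin : bounded_mfun (fun x => 2 * (c * lform (mean_kernel (point_mass x)) r)).
  by do 2!apply: bounded_mfunZ.
rewrite bounded_RintegralD; [|by apply: bounded_mfunD => //; exact: bounded_mfun_cst
  |exact: bounded_mfunZ].
rewrite bounded_RintegralD ?bounded_RintegralZ//; [|exact: bounded_mfunZ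
  |exact: bounded_mfun_cst].
rewrite Rintegral_probability_cst (qform_cons _ _ mean_kernelC) /= /diagonal_excess.
have -> : \int[m]_x lform (mean_kernel (point_mass x)) r = lform (mean_kernel m) r.
  rewrite bounded_Rintegral_sum => [|w]; last first.
    by apply: bounded_mfunZ; exact: bounded_mfun_mean_kernel_dirac.
  apply: eq_bigr => w _; rewrite bounded_RintegralZ ?Rintegral_mean_kernel_dirac//.
  exact: bounded_mfun_mean_kernel_dirac.
ring.
Qed.

Definition point_masses (s : seq (R * T)) : seq (R * probability T R) :=
  [seq (a.1, point_mass a.2) | a <- s].

Lemma qform_point_masses s : qform mean_kernel (point_masses s) = qform k s.
Proof.
rewrite /qform big_map; apply: eq_bigr => a _; congr (_ * _).
by rewrite /lform big_map; apply: eq_bigr => b _; rewrite mean_kernel_dirac2.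
Qed.

(* The quadratic form of [k] on a sample of the measures of [ws] is nonnegative, and
   the left-hand side is its mean. *)
Lemma qform_add_excess_ge0 (s : seq (R * T)) (ws : seq (R * probability T R)) :
  0 <= qform mean_kernel (point_masses s ++ ws) +
       \sum_(w <- ws) w.1 ^+ 2 * diagonal_excess w.2.
Proof.
elim: ws s => [|[c m] ws IH] s.
  rewrite cats0 big_nil addr0 qform_point_masses.
  by have /pos_def_kernelP[_] := kpd.
rewrite big_cons qform_catCA addrA -Rintegral_qform_dirac.
set excess := \sum_(w <- ws) _; rewrite -[excess]opprK subr_ge0.
rewrite -[leLHS](Rintegral_probability_cst m); apply: bounded_le_Rintegral.
- exact: bounded_mfun_cst.
- exact: bounded_mfun_qform_dirac.
- by move=> x; rewrite -subr_ge0 opprK; exact: (IH ((c, x) :: s)).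
Qed.

Lemma mean_kernel_pos_def : pos_def_kernel mean_kernel.
Proof.
apply/pos_def_kernelP; split=> [|ws]; first exact: mean_kernelC.
apply: (quadratic_ge0 (b := \sum_(w <- ws) w.1 ^+ 2 * diagonal_excess w.2)) => n.
by rewrite -qform_flatten_nseq -sum_flatten_nseq; exact: (qform_add_excess_ge0 [::]).
Qed.

Definition mmd_sqr p q := mean_kernel p p + mean_kernel q q - 2 * mean_kernel p q.

Lemma qform_difference p q (x : R) ws :
  qform mean_kernel [:: (x, p), (- x, q) & ws] = qform mean_kernel ws +
    2 * (x * (lform (mean_kernel p) ws - lform (mean_kernel q) ws)) + x ^+ 2 * mmd_sqr p q.
Proof.
rewrite !(qform_cons _ _ mean_kernelC) lform_cons /= /mmd_sqr; ring.
Qed.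

Lemma mmd_sqr_ge0 p q : 0 <= mmd_sqr p q.
Proof.
have /pos_def_kernelP[_ /(_ [:: (1, p); (- 1, q)])] := mean_kernel_pos_def.
by rewrite qform_difference /qform /lform !big_nil; congr (0 <= _); ring.
Qed.

Definition mean_difference p q x := \int[p]_y k x y - \int[q]_y k x y.

Lemma bounded_mfun_mean_difference p q : bounded_mfun (mean_difference p q).
Proof. by apply: bounded_mfunB; exact: bounded_mfun_Rintegral. Qed.

Lemma lform_mean_difference_le p q s :
  lform (mean_difference p q) s ^+ 2 <= qform k s * mmd_sqr p q.
Proof.
have lform_masses m : lform (mean_kernel m) (point_masses s) = lform (fun x => \int[m]_y k x y) s.
  by rewrite /lform big_map; apply: eq_bigr => a _ /=; rewrite mean_kernelC mean_kernel_dirac.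
have -> : lform (mean_difference p q) s =
    lform (mean_kernel p) (point_masses s) - lform (mean_kernel q) (point_masses s).
  by rewrite !lform_masses /lform -sumrB; apply: eq_bigr => a _; rewrite mulrBr.
apply: discriminant_le => [|x]; first exact: mmd_sqr_ge0.
rewrite -qform_point_masses -qform_difference.
by have /pos_def_kernelP[_] := mean_kernel_pos_def.
Qed.

Lemma Rintegral_mean_difference p q m :
  \int[m]_x mean_difference p q x = mean_kernel m p - mean_kernel m q.
Proof. by rewrite bounded_RintegralB//; exact: bounded_mfun_Rintegral. Qed.

Lemma rkhs_unit_ball_bounded_mfun f : rkhs_unit_ball k f -> bounded_mfun f.
Proof.
have [mk [B kB]] := bk; move=> ballf.
have B0 : 0 <= B by exact: le_trans (normr_ge0 _) (kB point).
have kxx x : k x x <= B by exact: le_trans (ler_norm _) (kB (x, x)).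
split; last first.
  by exists (Num.sqrt B) => x; apply: le_trans (norm_rkhs_unit_ball_le x ballf) (ler_wsqrtr _).
apply: uniform_limit_measurable => e e0.
have [s fs] := rkhs_unit_ball_approx kpd B0 kxx ballf e0.
exists (fun x => lform (k x) s) => //; apply: measurable_sum => a.
by apply: measurable_funM => //; case: (bounded_mfun_sectionr bk a.2).
Qed.

End MeanEmbedding.

Section MMD.
Context {R : realType} {d} {T : measurableType d}.
Variable k : T -> T -> R.
Hypothesis bk : bounded_mfun (fun z => k z.1 z.2).
Hypothesis kpd : pos_def_kernel k.
Implicit Types (p q : probability T R).

Lemma rkhs_unit_ball_mean_difference_le p q f : rkhs_unit_ball k f ->
  \int[p]_x f x - \int[q]_x f x <= Num.sqrt (mmd_sqr k p q).
Proof.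
move=> ballf; have bf := rkhs_unit_ball_bounded_mfun bk kpd ballf.
pose k' x y := k x y - f x * f y.
have bff : bounded_mfun (fun z => f z.1 * f z.2).
  apply: bounded_mfunM; apply: (bounded_mfun_comp bf); first exact: measurable_fst.
  exact: measurable_snd.
have bk' : bounded_mfun (fun z => k' z.1 z.2) by exact: bounded_mfunB.
have mean_k' m m' : mean_kernel k' m m' =
    mean_kernel k m m' - (\int[m]_x f x) * \int[m']_x f x.
  have inner x : \int[m']_y k' x y = \int[m']_y k x y - (\int[m']_y f y) * f x.
    rewrite bounded_RintegralB ?bounded_RintegralZ 1?mulrC//.
      exact: bounded_mfun_sectionl.
    exact: bounded_mfunZ.
  rewrite /mean_kernel; under eq_Rintegral do rewrite inner.
  rewrite bounded_RintegralB ?bounded_RintegralZ 1?mulrC//.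
    exact: bounded_mfun_Rintegral.
  exact: bounded_mfunZ.
have := mmd_sqr_ge0 bk' (pos_def_kernel_sub kpd ballf) p q.
rewrite /mmd_sqr !mean_k' => mmd_ge.
apply: le_trans (ler_norm _) _; rewrite -sqrtr_sqr ler_wsqrtr//; nra.
Qed.

Lemma mean_difference_unit_ball p q (c : R) : c ^+ 2 * mmd_sqr k p q <= 1 ->
  rkhs_unit_ball k (fun x => c * mean_difference k p q x).
Proof.
move=> c1; apply/rkhs_unit_ballP => s.
have -> : lform (fun x => c * mean_difference k p q x) s = c * lform (mean_difference k p q) s.
  by rewrite /lform mulr_sumr; apply: eq_bigr => a _; rewrite mulrCA.
have /pos_def_kernelP[_ /(_ s) qs] := kpd.
rewrite exprMn; apply: (@le_trans _ _ (c ^+ 2 * (qform k s * mmd_sqr k p q))).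
  by rewrite ler_wpM2l ?sqr_ge0// lform_mean_difference_le.
by rewrite mulrCA ler_piMr.
Qed.

Lemma mmdE p q : mmd k p q = Num.sqrt (mmd_sqr k p q).
Proof.
have mmd0 := mmd_sqr_ge0 bk kpd p q.
pose S := [set fine (\int[p]_x (f x)%:E) - fine (\int[q]_x (f x)%:E) | f in rkhs_unit_ball k].
have ubS : ubound S (Num.sqrt (mmd_sqr k p q)).
  by move=> _ [f ballf <-]; exact: rkhs_unit_ball_mean_difference_le.
pose c := (Num.sqrt (mmd_sqr k p q))^-1.
have [c1 cmmd] : c ^+ 2 * mmd_sqr k p q <= 1 /\ c * mmd_sqr k p q = Num.sqrt (mmd_sqr k p q).
  rewrite /c exprVn sqr_sqrtr//; have [->|mmdn0] := eqVneq (mmd_sqr k p q) 0.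
    by rewrite sqrtr0 !mulr0.
  by rewrite mulVf// -[X in _ * X]sqr_sqrtr// expr2 mulKf// gt_eqF// sqrtr_gt0 lt_def mmdn0.
have Smmd : S (Num.sqrt (mmd_sqr k p q)).
  exists (fun x => c * mean_difference k p q x); first exact: mean_difference_unit_ball.
  have bdiff := bounded_mfun_mean_difference bk p q.
  have mean_witness (m : probability T R) : fine (\int[m]_x (c * mean_difference k p q x)%:E) =
      c * (mean_kernel k m p - mean_kernel k m q).
    by rewrite -Rintegral_mean_difference// -bounded_RintegralZ.
  by rewrite !mean_witness -mulrBr -cmmd /mmd_sqr (mean_kernelC bk kpd q p); congr (_ * _); ring.
apply/eqP; rewrite eq_le; apply/andP; split.
  by apply: ge_sup => //; exists (Num.sqrt (mmd_sqr k p q)).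
by apply: ub_le_sup => //; exists (Num.sqrt (mmd_sqr k p q)).
Qed.

End MMD.

(** * The estimated dissimilarities *)

Lemma sqr_sqrt_sub_le {R : rcfType} (a b : R) : (Num.sqrt a - Num.sqrt b) ^+ 2 <= `|a - b|.
Proof.
wlog ba : a b / b <= a => [wlog_le|].
  have [/wlog_le//|/ltW/wlog_le] := leP b a.
  by rewrite distrC -sqrrN opprB.
have sb0 := sqrtr_ge0 b; have sba := ler_wsqrtr ba.
rewrite ger0_norm ?subr_ge0//; have [a0|a0] := leP 0 a; last first.
  rewrite !ler0_sqrtr ?(ltW a0)// ?(le_trans ba)// ?subrr ?expr0n/= ?subr_ge0//.
  exact: ltW.
have sa2 := sqr_sqrtr a0; have [b0|b0] := leP 0 b.
  have sb2 := sqr_sqrtr b0; nra.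
rewrite (ler0_sqrtr (ltW b0)) subr0 sa2; lra.
Qed.

Lemma measure_bigsetU_le {R : realType} {d} {T : measurableType d}
    (mu : {measure set T -> \bar R}) {I : Type} (s : seq I) (Q : pred I) (F : I -> set T) :
  (forall i, measurable (F i)) ->
  (mu (\big[setU/set0]_(i <- s | Q i) F i) <= \sum_(i <- s | Q i) mu (F i))%E.
Proof.
move=> mF; elim: s => [|i s IH]; first by rewrite !big_nil measure0.
rewrite !big_cons; case: ifP => // _; apply: le_trans (measureU2 _ _ _) _ => //.
  exact: bigsetU_measurable.
by rewrite leeD.
Qed.

Section Estimate.
Context {R : realType} {dO dT : measure_display}.
Context {Omega : measurableType dO} {T : measurableType dT}.
Variables (P : probability Omega R) (M : nat) (p : 'I_M -> probability T R).
Variable X : 'I_M -> nat -> Omega -> T.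
Hypothesis mX : forall i l, measurable_fun setT (X i l).
Hypothesis lawX : forall i l (B : set T), measurable B -> P (X i l @^-1` B) = p i B.
Hypothesis indX : independent P (fun il : 'I_M * nat => X il.1 il.2).
Variables (k : T -> T -> R) (G : R).
Hypothesis mk : measurable_fun setT (fun z : T * T => k z.1 z.2).
Hypothesis kpd : pos_def_kernel k.
Hypothesis G0 : 0 < G.
Hypothesis kG : forall x y, `|k x y| <= G.

Let bk : bounded_mfun (fun z => k z.1 z.2).
Proof. by split=> //; exists G => z. Qed.

Lemma sample_kernel_mean i l j m : (i, l) != (j, m) ->
  \int[P]_w k (X i l w) (X j m w) = mean_kernel k (p i) (p j).
Proof.
move=> ilm; apply: (Rintegral_indep_pair (mX i l) (mX j m) _ bk) => A B mA mB.
have := indX (t := [:: ((i, l), A); ((j, m), B)]).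
rewrite !cylinder_cons !marginal_prod_cons /cylinder /marginal_prod !big_nil setIT mule1 /= !lawX//.
by apply; split=> [|q]; rewrite /= !inE ?ilm// => /orP[]/eqP->.
Qed.

Section Pair.
Variables i j : 'I_M.

Definition dipole_kernel (z z' : T * T) :=
  k z.1 z'.1 + k z.2 z'.2 - k z.1 z'.2 - k z'.1 z.2.
Definition paired_sample l w := (X i l w, X j l w).

Local Notation vstat := (vstat_sum paired_sample dipole_kernel).

Lemma measurable_paired_sample l : measurable_fun setT (paired_sample l).
Proof. exact: measurable_fun_pair. Qed.

Lemma measurable_dipole_kernel :
  measurable_fun setT (fun z : (T * T) * (T * T) => dipole_kernel z.1 z.2).
Proof.
have mcomp (u v : (T * T) * (T * T) -> T) : measurable_fun setT u -> measurable_fun setT v ->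
    measurable_fun setT (fun z => k (u z) (v z)).
  by move=> mu mv; case: (bounded_mfun_comp2 bk mu mv).
have m1 (f : T * T -> T) : measurable_fun setT f ->
    measurable_fun setT (fun z : (T * T) * (T * T) => f z.1).
  by move=> mf; apply: (measurableT_comp mf); exact: measurable_fst.
have m2 (f : T * T -> T) : measurable_fun setT f ->
    measurable_fun setT (fun z : (T * T) * (T * T) => f z.2).
  by move=> mf; apply: (measurableT_comp mf); exact: measurable_snd.
have mfst := @measurable_fst _ _ T T; have msnd := @measurable_snd _ _ T T.
apply: measurable_funB; last by apply: mcomp; [exact: m2|exact: m1].
apply: measurable_funB; last by apply: mcomp; [exact: m1|exact: m2].
by apply: measurable_funD; apply: mcomp; (exact: m1) || exact: m2.
Qed.

Lemma norm_dipole_kernel_le z z' : `|dipole_kernel z z'| <= 4 * G.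
Proof.
have := kG z.1 z'.1; have := kG z.2 z'.2; have := kG z.1 z'.2; have := kG z'.1 z.2.
rewrite /dipole_kernel !ler_norml => /andP[? ?] /andP[? ?] /andP[? ?] /andP[? ?].
by apply/andP; split; lra.
Qed.

Lemma dipole_kernel_mean l m : l != m ->
  \int[P]_w dipole_kernel (paired_sample l w) (paired_sample m w) = mmd_sqr k (p i) (p j).
Proof.
move=> lm; have bkX a l1 b l2 : bounded_mfun (fun w => k (X a l1 w) (X b l2 w)).
  exact: bounded_mfun_comp2.
have neq a b l1 l2 : l1 != l2 -> (a, l1) != (b, l2) :> 'I_M * nat.
  by rewrite xpair_eqE => /negbTE ->; rewrite andbF.
have ml : m != l by rewrite eq_sym.
have bself := bounded_mfunD (bkX i l i m) (bkX j l j m).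
have bself_cross := bounded_mfunB bself (bkX i l j m).
rewrite (bounded_RintegralB P bself_cross (bkX i m j l)).
rewrite (bounded_RintegralB P bself (bkX i l j m)) bounded_RintegralD//.
by rewrite !sample_kernel_mean ?neq// /mmd_sqr; ring.
Qed.

Lemma dhatE n w : dhat k X i j n w = Num.sqrt ((n%:R ^+ 2)^-1 * vstat n w).
Proof.
rewrite /dhat; congr (Num.sqrt (_ * _)); rewrite /vstat_sum /dipole_kernel/=.
transitivity (\sum_(l < n) \sum_(m < n) (k (X i l w) (X i m w) + k (X j l w) (X j m w)
    - k (X i l w) (X j m w)) - \sum_(l < n) \sum_(m < n) k (X i m w) (X j l w)).
  rewrite [X in _ - X]exchange_big/= -sumrB; apply: eq_bigr => l _.
  by rewrite -sumrB; apply: eq_bigr => m _; ring.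
by rewrite -sumrB; apply: eq_bigr => l _; rewrite -sumrB.
Qed.

Lemma measurable_dhat n : measurable_fun setT (dhat k X i j n).
Proof.
rewrite (funext (dhatE n)).
have msqrt := continuous_measurable_fun (@sqrt_continuous R).
apply: (measurableT_comp msqrt); apply: measurable_funM => //.
exact: (measurable_vstat_sum measurable_paired_sample measurable_dipole_kernel
  norm_dipole_kernel_le).
Qed.

Lemma dhat_le n w : dhat k X i j n w <= Num.sqrt (4 * G).
Proof.
rewrite dhatE ler_wsqrtr//; case: n => [|n].
  by rewrite /vstat_sum big_ord0 mulr0 mulr_ge0// ltW.
rewrite mulrC ler_pdivrMr ?exprn_gt0 ?ltr0n//.
apply: (@le_trans _ _ (\sum_(l < n.+1) \sum_(m < n.+1) (4 * G))).
  apply: ler_sum => l _; apply: ler_sum => m _.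
  by rewrite (le_trans (ler_norm _))// norm_dipole_kernel_le.
by rewrite !sumr_const card_ord expr2 mulrA !mulr_natr.
Qed.

Lemma paired_sample_independent : i != j -> independent P paired_sample.
Proof.
move=> ij; apply: (independent_pairs (X := fun il : 'I_M * nat => X il.1 il.2)
  (f := fun l => (i, l)) (g := fun l => (j, l))) => //.
- by move=> ? ? [].
- by move=> ? ? [].
- by move=> ? ?; rewrite xpair_eqE (negbTE ij).
Qed.

Lemma dhat_exp_decay (eta : R) : i != j -> 0 < eta ->
  exp_decay (fun n =>
    P [set w | (eta <= `|dhat k X i j n w - mmd k (p i) (p j)|)%R]).
Proof.
move=> ij eta0; have G40 : 0 < 4 * G by exact: mulr_gt0.
have := vstat_sum_exp_decay measurable_paired_sample (paired_sample_independent ij)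
  measurable_dipole_kernel G40 norm_dipole_kernel_le dipole_kernel_mean (exprn_gt0 2 eta0).
apply: exp_decay_le => n; apply: le_measure; rewrite ?inE.
- apply: measurable_set_ge; apply: measurableT_comp => //; apply: measurable_funB => //.
  exact: measurable_dhat.
- apply: measurable_set_ge; apply: measurableT_comp => //; apply: measurable_funB => //.
  exact: (measurable_vstat_sum measurable_paired_sample measurable_dipole_kernel
    norm_dipole_kernel_le).
move=> w /=; rewrite dhatE mmdE//; case: n => [|n] far; first by rewrite expr0n mulr0.
have n0 : n.+1%:R ^+ 2 != 0 :> R by rewrite expf_neq0.
have -> : vstat n.+1 w - n.+1%:R ^+ 2 * mmd_sqr k (p i) (p j) =
    n.+1%:R ^+ 2 * ((n.+1%:R ^+ 2)^-1 * vstat n.+1 w - mmd_sqr k (p i) (p j)).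
  by rewrite [RHS]mulrBr mulVKf.
rewrite normrM ger0_norm ?sqr_ge0// mulrC ler_wpM2l ?sqr_ge0//.
apply: le_trans (sqr_sqrt_sub_le _ _); rewrite -[leRHS]real_normK ?num_real//.
by rewrite lerXn2r// nnegrE// ltW.
Qed.

End Pair.

Definition deviation_event (eta : R) n : set Omega :=
  \big[setU/set0]_(q : 'I_M * 'I_M | q.1 != q.2)
    [set w | eta <= `|dhat k X q.1 q.2 n w - mmd k (p q.1) (p q.2)|].

Lemma measurable_deviation (eta : R) n (q : 'I_M * 'I_M) :
  measurable [set w | eta <= `|dhat k X q.1 q.2 n w - mmd k (p q.1) (p q.2)|].
Proof.
apply: measurable_set_ge; apply: measurableT_comp => //; apply: measurable_funB => //.
exact: measurable_dhat.
Qed.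

Lemma measurable_deviation_event eta n : measurable (deviation_event eta n).
Proof. by apply: bigsetU_measurable => q _; exact: measurable_deviation. Qed.

Lemma dhat_close eta n w : ~ deviation_event eta n w ->
  forall i j, i != j -> `|dhat k X i j n w - mmd k (p i) (p j)| < eta.
Proof.
move=> close i j ij; rewrite ltNge; apply/negP => far; apply: close.
by rewrite /deviation_event (bigD1 (i, j))//; left.
Qed.

Lemma deviation_event_exp_decay eta : 0 < eta ->
  exp_decay (fun n => P (deviation_event eta n)).
Proof.
move=> eta0; apply: exp_decay_le (fun n => measure_bigsetU_le _ _ _ (measurable_deviation eta n)) _.
by apply: exp_decay_sum => -[i j] ij; exact: dhat_exp_decay.
Qed.

End Estimate.

(** * The stopping time *)

Lemma measurable_inf_image {R : realType} {d} {T : measurableType d} {I : finType}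
    (D : pred I) (F : I -> T -> R) : (forall i, measurable_fun setT (F i)) ->
  measurable_fun setT (fun w => inf [set F i w | i in D]).
Proof.
move=> mF; case: (pickP D) => [i0 Di0|D0]; last first.
  rewrite (_ : (fun w => _) = cst (inf set0)); first exact: measurable_cst.
  apply/funext => w; congr inf; apply/seteqP; split=> // x [i Di _].
  by have := D0 i; rewrite [D i]Di.
have inf_bigmin w : inf [set F i w | i in D] = \big[Num.min/F i0 w]_(i | D i) F i w.
  have lbF : has_lbound [set F i w | i in D].
    exists (\big[Num.min/F i0 w]_i F i w) => _ [i _ <-]; exact: bigmin_le.
  apply/eqP; rewrite eq_le; apply/andP; split.
    apply: le_bigmin => [|i Di]; apply: ge_inf => //; [by exists i0|by exists i].
  apply: lb_le_inf => [|_ [i Di <-]]; last exact: bigmin_le_cond.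
  by exists (F i0 w), i0.
rewrite (funext inf_bigmin); elim: (index_enum I) => [|i s IH].
  by under eq_fun do rewrite big_nil; exact: mF.
have [Di|/negbTE Di] := boolP (D i); last by under eq_fun do rewrite big_cons Di.
by under eq_fun do rewrite big_cons Di; exact: measurable_minr.
Qed.

Section InterMin.
Context {R : realType} {M : nat}.
Implicit Types (d : 'I_M -> 'I_M -> R) (Q : {set {set 'I_M}}).

Definition across Q (q : 'I_M * 'I_M) : bool :=
  [exists A in Q, exists B in Q, [&& A != B, q.1 \in A & q.2 \in B]].

Lemma inter_min_image d Q : inter_min d Q = inf [set d q.1 q.2 | q in across Q].
Proof.
rewrite /inter_min; congr inf; apply/seteqP; split=> r.
  move=> [i [j [A [B [[QA QB AB iA jB] ->]]]]]; exists (i, j) => //.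
  apply/exists_inP; exists A => //; apply/exists_inP; exists B => //.
  by rewrite AB iA.
move=> [[i j] /exists_inP[A QA /exists_inP[B QB /and3P[AB iA jB]]] <-].
by exists i, j, A, B.
Qed.

Lemma measurable_inter_min {disp} {Omega : measurableType disp} (d : Omega -> 'I_M -> 'I_M -> R) Q :
  (forall i j, measurable_fun setT (fun w => d w i j)) ->
  measurable_fun setT (fun w => inter_min (d w) Q).
Proof.
move=> md; under eq_fun do rewrite inter_min_image.
by apply: measurable_inf_image => q; exact: md.
Qed.

Lemma inter_min_le_bound d Q (b : R) : 0 <= b -> (forall i j, 0 <= d i j <= b) ->
  inter_min d Q <= b.
Proof.
move=> b0 db; rewrite inter_min_image; set S := [set _ | _ in _].
have [->|/set0P[r Sr]] := eqVneq S set0; first by rewrite inf0.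
have lbS : has_lbound S by exists 0 => _ [q _ <-]; have /andP[] := db q.1 q.2.
apply: le_trans (ge_inf lbS Sr) _; case: Sr => q _ <-.
by have /andP[] := db q.1 q.2.
Qed.

End InterMin.

Section Stopping.
Context {R : realType} {dO : measure_display} {Omega : measurableType dO}.
Context {T : Type} {M : nat}.
Variables (P : probability Omega R) (k : T -> T -> R) (X : 'I_M -> nat -> Omega -> T).
Variables (cl : nat -> Omega -> {set {set 'I_M}}) (C : R).
Hypothesis mdhat : forall i j n, measurable_fun setT (dhat k X i j n).
Hypothesis mcl : forall n (Q : {set {set 'I_M}}), measurable (cl n @^-1` [set Q]).

Local Notation stops n := [set w | stop_cond k X cl C n w].
Local Notation tau := (stop_time k X cl C).

Lemma dhat_ge0 i j n w : 0 <= dhat k X i j n w.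
Proof. exact: sqrtr_ge0. Qed.

Lemma stop_timeP w :
  (exists n, [/\ stops n w, (forall m, stops m w -> (n <= m)%N) & tau w = (n%:R)%:E]) \/
  ((forall n, ~ stops n w) /\ tau w = +oo%E).
Proof.
rewrite /stop_time; case: pselect => [stopped|running]; [left|right].
  case: ex_minnP => n /asboolP stop_n n_min; exists n; split=> // m stop_m.
  by apply: n_min; apply/asboolP.
by split=> // n stop_n; apply: running; exists n.
Qed.

Lemma measurable_stop_cond n : measurable (stops n).
Proof.
have [n2|n2] := leqP 2 n; last first.
  by rewrite (_ : stops n = set0)//; apply/seteqP; split=> // w []; rewrite leqNgt n2.
have -> : stops n = \bigcup_(Q in [set: {set {set 'I_M}}]) (cl n @^-1` [set Q] `&`
     [set w | C / Num.sqrt n%:R <= inter_min (fun i j => dhat k X i j n w) Q]).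
  apply/seteqP; split=> w /=; first by move=> [_ stop_n]; exists (cl n w).
  by move=> [Q _ [/= <-]].
apply: fin_bigcup_measurable => // Q _; apply: measurableI => //.
by apply: measurable_set_ge; exact: measurable_inter_min.
Qed.

Definition running n := \bigcap_(m in `I_n.+1) ~` stops m.

Lemma measurable_running n : measurable (running n).
Proof.
apply: fin_bigcap_measurable => // m _; apply: measurableC; exact: measurable_stop_cond.
Qed.

Lemma runningP n w : running n w <-> (n%:R%:E < tau w)%E.
Proof.
case: (stop_timeP w) => [[m [stop_m m_min ->]]|[never ->]].
  rewrite lte_fin ltr_nat; split=> [run|nm i /= i_n stop_i].
    by rewrite ltnNge; apply/negP => mn; exact: (run m).
  by have := m_min i stop_i; rewrite leqNgt (leq_trans i_n).
by rewrite ltry; split=> // _ i _; exact: never.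
Qed.

Lemma stop_time_series w : tau w = (\sum_(n <oo) (\1_(running n) w)%:E)%E.
Proof.
have ind_ge0 n : (0 <= n)%N -> (0 <= (\1_(running n) w : R)%:E)%E by rewrite lee_fin.
have head_sum n : (n%:R%:E <= tau w)%E ->
    (\sum_(0 <= m < n) (\1_(running m) w : R)%:E = n%:R%:E)%E.
  move=> n_tau; rewrite (eq_big_nat _ _ (F2 := fun=> 1%E)) => [|m /andP[_ mn]].
    by rewrite big_mkord sumEFin sumr_const card_ord.
  rewrite indicE mem_set//; apply/runningP; apply: lt_le_trans n_tau.
  by rewrite lte_fin ltr_nat.
case: (stop_timeP w) => [[n [_ _ tauE]]|[_ tauE]].
  rewrite (nneseries_split 0 n)// add0n head_sum ?tauE// eseries0 ?adde0// => m nm _.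
  rewrite indicE memNset// => /runningP; rewrite tauE lte_fin ltr_nat ltnNge.
  by rewrite nm.
rewrite tauE; apply/esym/eq_infty => r.
apply: le_trans (nneseries_lim_ge (P := xpredT) (Num.truncn r).+1 _) => //.
by rewrite head_sum ?tauE ?leey// lee_fin ltW// truncnS_gt.
Qed.

Lemma measurable_stop_time : measurable_fun setT tau.
Proof.
rewrite (funext stop_time_series).
apply: (@ge0_emeasurable_sum _ _ R setT (fun n w => (\1_(running n) w)%:E) xpredT).
- by move=> n w _ _; rewrite lee_fin.
- by move=> n _; apply/measurable_EFinP/measurable_indic/measurable_running.
Qed.

Lemma expected_stop_time : (\int[P]_w tau w = \sum_(n <oo) P (running n))%E.
Proof.
under eq_integral do rewrite stop_time_series.
rewrite integral_nneseries//; last first.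
  by move=> n; apply/measurable_EFinP/measurable_indic/measurable_running.
by apply: eq_eseriesr => n _; rewrite integral_indic ?setIT//; exact: measurable_running.
Qed.

Lemma measurable_error_event Pi : measurable (error_event k X cl C Pi).
Proof.
have -> : error_event k X cl C Pi =
    ~` \bigcup_n (tau @^-1` [set (n%:R)%:E] `&` cl n @^-1` [set Pi]).
  apply/seteqP; split=> w /= err; last by move=> [n correct]; apply: err; exists n.
  by move=> [n _ correct]; apply: err; exists n.
apply: measurableC; apply: bigcupT_measurable => n; apply: measurableI => //.
by apply: measurable_preimage; [exact: measurable_stop_time|exact: emeasurable_set1].
Qed.

Section Deviation.
Variables (dev : nat -> set Omega) (n1 n2 : nat) (Pi : {set {set 'I_M}}).
Hypothesis mdev : forall n, measurable (dev n).
Hypothesis stop_after : forall n w, (n2 <= n)%N -> ~ dev n w -> stops n w.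

Lemma expected_stop_time_le :
  (\int[P]_w tau w <= (n2%:R)%:E + \sum_(n <oo) P (dev (n2 + n)))%E.
Proof.
have mrun n := measurable_running n.
rewrite expected_stop_time (nneseries_split 0 n2)// add0n; apply: leeD.
  apply: (@le_trans _ _ (\sum_(0 <= n < n2) 1)%E).
    by apply: lee_sum => n _; exact: probability_le1.
  by rewrite big_mkord sumEFin sumr_const card_ord.
rewrite -(nneseries_addn (f := fun n => P (running n)))//; apply: lee_nneseries => // n _.
rewrite addnC; apply: le_measure; rewrite ?inE// => w run; apply: contrapT => nodev.
by apply: (run (n2 + n)%N) => //=; apply: stop_after => //; exact: leq_addr.
Qed.

Hypothesis stop_before : forall n w, stops n w -> (n1 <= n)%N.
Hypothesis correct : forall n w, ~ dev n w -> cl n w = Pi.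

Lemma error_event_le :
  (P (error_event k X cl C Pi) <= \sum_(n <oo) P (dev (n1 + n)))%E.
Proof.
apply: measure_sigma_subadditive => //; first exact: measurable_error_event.
move=> w err; apply: contrapT => nodev.
have good n : (n1 <= n)%N -> ~ dev n w.
  by move=> n1n dev_n; apply: nodev; exists (n - n1)%N => //; rewrite subnKC.
case: (stop_timeP w) => [[n [stop_n _ tauE]]|[/(_ (n1 + n2)%N) + _]].
  by apply: err; exists n; split=> //; apply: correct; exact: good (stop_before stop_n).
apply; apply: stop_after; first exact: leq_addl.
by apply: good; exact: leq_addr.
Qed.

End Deviation.
End Stopping.

(** * Exponential consistency *)

Section SlinkSeq.
Context {R : realType} {dO : measure_display} {Omega : measurableType dO}.
Context {T : Type} {M : nat}.
Variables (P : probability Omega R) (k : T -> T -> R) (X : 'I_M -> nat -> Omega -> T).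
Variables (cl : nat -> Omega -> {set {set 'I_M}}) (Pi : {set {set 'I_M}}).
Variables (d : 'I_M -> 'I_M -> R) (dev : nat -> set Omega) (eta r A c C : R).
Hypothesis mdhat : forall i j n, measurable_fun setT (dhat k X i j n).
Hypothesis mcl : forall n (Q : {set {set 'I_M}}), measurable (cl n @^-1` [set Q]).
Hypothesis slink : forall n w, slink_output (fun i j => dhat k X i j n w) #|Pi| (cl n w).
Hypothesis Pi_part : finset.partition Pi [set: 'I_M]%SET.
Hypothesis card_Pi : (1 < #|Pi|)%N.
Hypothesis d_ge0 : forall i j, 0 <= d i j.
Hypothesis separated : d_I d Pi + 3 * eta < d_H d Pi.
Hypothesis gap_gt0 : 0 < d_H d Pi - eta.
Hypothesis r_gt0 : 0 < r.
Hypothesis dhat_r : forall i j n w, dhat k X i j n w <= r.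
Hypothesis mdev : forall n, measurable (dev n).
Hypothesis close : forall n w, ~ dev n w ->
  forall i j, i != j -> `|dhat k X i j n w - d i j| < eta.
Hypotheses (A_gt0 : 0 < A) (c_gt0 : 0 < c) (C_gt0 : 0 < C).
Hypothesis dev_le : forall n, (P (dev n) <= (A * expR (- (c * n%:R)))%:E)%E.

Local Notation gap := (d_H d Pi - eta).

Lemma slink_correct_of_close n w : ~ dev n w -> cl n w = Pi.
Proof.
move=> nodev; apply: (slink_output_correct Pi_part d_ge0 _ (close nodev) separated) => //.
by move=> i j; exact: dhat_ge0.
Qed.

Lemma le_threshold (g : R) n : 0 < g -> (0 < n)%N ->
  (C / Num.sqrt n%:R <= g) = (C ^+ 2 / g ^+ 2 <= n%:R).
Proof.
move=> g0 n0; have nR0 : 0 < n%:R :> R by rewrite ltr0n.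
rewrite ler_pdivrMr ?sqrtr_gt0// ler_pdivrMr ?exprn_gt0// [n%:R * _]mulrC.
rewrite -(@ler_pXn2r _ 2%N) ?nnegrE ?mulr_ge0 ?sqrtr_ge0 ?(ltW C_gt0) ?(ltW g0)//.
by rewrite exprMn sqr_sqrtr// ltW.
Qed.

Lemma stop_cond_ge n w : stop_cond k X cl C n w -> C ^+ 2 / r ^+ 2 <= n%:R.
Proof.
move=> [n2 stop_n]; rewrite -le_threshold// ?(leq_trans _ n2)//; apply: le_trans stop_n _.
by apply: inter_min_le_bound => [|i j]; rewrite ?(ltW r_gt0)// dhat_ge0 dhat_r.
Qed.

Lemma stop_cond_of_close n w : (2 <= n)%N -> C ^+ 2 / gap ^+ 2 <= n%:R -> ~ dev n w ->
  stop_cond k X cl C n w.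
Proof.
move=> n2 nC nodev; split=> //; rewrite slink_correct_of_close//.
apply: le_trans (inter_min_close Pi_part d_ge0 (close nodev) card_Pi).
by rewrite le_threshold// (leq_trans _ n2).
Qed.

Let n2 := (Num.truncn (C ^+ 2 / gap ^+ 2)).+2.

Let stop_after n w : (n2 <= n)%N -> ~ dev n w -> stop_cond k X cl C n w.
Proof.
move=> n2n; apply: stop_cond_of_close; first exact: leq_trans n2n.
by apply: le_trans (ltW (truncnS_gt _)) _; rewrite ler_nat (leq_trans _ n2n).
Qed.

Lemma slink_seq_error_le : (P (error_event k X cl C Pi) <=
  (A / (1 - expR (- c)) * expR (- (c * (C ^+ 2 / r ^+ 2))))%:E)%E.
Proof.
have exn : exists n : nat, C ^+ 2 / r ^+ 2 <= n%:R.
  by exists (Num.truncn (C ^+ 2 / r ^+ 2)).+1; exact: ltW (truncnS_gt _).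
case: (ex_minnP exn) => n1 n1_ge n1_min.
apply: le_trans (exp_decay_tail_sum_le A_gt0 c_gt0 n1_ge _ dev_le) => //.
apply: (error_event_le P mdhat mcl mdev stop_after) => [n w /stop_cond_ge|].
  exact: n1_min.
exact: slink_correct_of_close.
Qed.

Lemma slink_seq_expected_stop_time_le : (\int[P]_w stop_time k X cl C w <=
  ((gap ^+ 2)^-1 * C ^+ 2 + (2 + A / (1 - expR (- c))))%:E)%E.
Proof.
apply: le_trans (expected_stop_time_le P mdhat mcl mdev stop_after) _.
have tail : (\sum_(n <oo) P (dev (n2 + n)) <= (A / (1 - expR (- c)))%:E)%E.
  have := exp_decay_tail_sum_le A_gt0 c_gt0 (ler0n R n2) (fun n => measure_ge0 P _) dev_le.
  by rewrite mulr0 oppr0 expR0 mulr1.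
apply: le_trans (leeD2l _ tail) _; rewrite -EFinD lee_fin addrA lerD2r.
by rewrite /n2 -addn2 natrD lerD2r [_^-1 * _]mulrC truncn_le divr_ge0// sqr_ge0.
Qed.

End SlinkSeq.

Lemma le_log_error_ratio {R : realType} (L K a b eps : R) :
  0 < L -> 0 < a -> 0 < b -> 0 < eps ->
  exists s0, forall (s : R) (m pe : \bar R), s0 <= s -> pe != 0%E -> (0 <= pe)%E ->
    (pe <= (L * expR (- (a * s)))%:E)%E -> (m <= (b * s + K)%:E)%E ->
    (m <= ((1 + eps) * (- ln (fine pe)) / (a / b))%:E)%E.
Proof.
move=> L0 a0 b0 eps0; exists ((K + (1 + eps) * (b / a) * ln L) / (eps * b)).
move=> s m pe s_ge pe_neq0 pe_ge0 pe_le m_le; apply: le_trans m_le _; rewrite lee_fin.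
have pe_fin : pe \is a fin_num by rewrite ge0_fin_numE// (le_lt_trans pe_le)// ltry.
have pe_gt0 : 0 < fine pe by rewrite fine_gt0// lt0e pe_neq0 pe_ge0 -ge0_fin_numE.
rewrite -(fineK pe_fin) lee_fin in pe_le.
have log_pe : a * s - ln L <= - ln (fine pe).
  rewrite lerNr opprB -(expRK (- (a * s))) -lnM ?posrE ?expR_gt0//.
  by rewrite ler_ln ?posrE ?mulr_gt0 ?expR_gt0.
have {}s_ge : K + (1 + eps) * (b / a) * ln L <= eps * b * s.
  by rewrite [leRHS]mulrC -ler_pdivrMr ?mulr_gt0.
rewrite invf_div; apply: (@le_trans _ _ ((1 + eps) * (a * s - ln L) * (b / a))).
  have -> : (1 + eps) * (a * s - ln L) * (b / a) =
    b * s + eps * b * s - (1 + eps) * (b / a) * ln L by field; rewrite gt_eqF.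
  lra.
by rewrite ler_wpM2r ?divr_ge0 ?ler_wpM2l ?(ltW a0) ?(ltW b0)//; lra.
Qed.

Section Consistency.
Context {R : realType} {dO : measure_display} {Omega : measurableType dO}.
Context {T : Type} {M : nat}.
Variables (P : probability Omega R) (k : T -> T -> R) (X : 'I_M -> nat -> Omega -> T).
Variables (Pi : {set {set 'I_M}}) (d : 'I_M -> 'I_M -> R) (dev : nat -> set Omega).
Variables (eta r : R).
Hypothesis mdhat : forall i j n, measurable_fun setT (dhat k X i j n).
Hypothesis Pi_part : finset.partition Pi [set: 'I_M]%SET.
Hypothesis card_Pi : (1 < #|Pi|)%N.
Hypothesis d_ge0 : forall i j, 0 <= d i j.
Hypothesis separated : d_I d Pi + 3 * eta < d_H d Pi.
Hypothesis gap_gt0 : 0 < d_H d Pi - eta.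
Hypothesis r_gt0 : 0 < r.
Hypothesis dhat_r : forall i j n w, dhat k X i j n w <= r.
Hypothesis mdev : forall n, measurable (dev n).
Hypothesis close : forall n w, ~ dev n w ->
  forall i j, i != j -> `|dhat k X i j n w - d i j| < eta.
Hypothesis dev_decay : exp_decay (fun n => P (dev n)).

Lemma slink_seq_exponentially_consistent : exists alpha : R, 0 < alpha /\
  forall cl : nat -> Omega -> {set {set 'I_M}},
    (forall n w, slink_output (fun i j => dhat k X i j n w) #|Pi| (cl n w)) ->
    (forall n (Q : {set {set 'I_M}}), measurable (cl n @^-1` [set Q])) ->
    forall eps : R, 0 < eps -> exists C0 : R, forall C : R, C0 <= C ->
      P (error_event k X cl C Pi) = 0%E \/
      (\int[P]_w stop_time k X cl C w <=
        ((1 + eps) * (- ln (fine (P (error_event k X cl C Pi)))) / alpha)%:E)%E.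
Proof.
have [A [c [A0 c0 dev_le]]] := dev_decay.
pose L := A / (1 - expR (- c)); pose a := c / r ^+ 2; pose b := ((d_H d Pi - eta) ^+ 2)^-1.
have L0 : 0 < L by rewrite divr_gt0// subr_gt0 expR_lt1 oppr_lt0.
have a0 : 0 < a by rewrite divr_gt0// exprn_gt0.
have b0 : 0 < b by rewrite invr_gt0 exprn_gt0.
exists (a / b); split; [exact: divr_gt0|move=> cl slink mcl eps eps0].
have [s0 ratio] := le_log_error_ratio (2 + L) L0 a0 b0 eps0.
exists (1 + `|s0|) => C C_ge.
have C0 : 0 < C by apply: lt_le_trans C_ge; rewrite ltr_pwDl.
have s0C : s0 <= C ^+ 2 by have := ler_norm s0; have := normr_ge0 s0; nra.
have [Pe0|Pe0] := eqVneq (P (error_event k X cl C Pi)) 0%E; [by left|right].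
apply: (ratio (C ^+ 2)) => //.
  have -> : a * C ^+ 2 = c * (C ^+ 2 / r ^+ 2) by rewrite /a mulrAC mulrA.
  exact: (slink_seq_error_le mdhat mcl slink Pi_part card_Pi d_ge0 separated gap_gt0
    r_gt0 dhat_r mdev close).
exact: (slink_seq_expected_stop_time_le mdhat mcl slink Pi_part card_Pi d_ge0 separated
  gap_gt0 mdev close).
Qed.

End Consistency.

Theorem theorem5 (R : realType)
  (dO : measure_display) (Omega : measurableType dO) (P : probability Omega R)
  (dT : measure_display) (T : measurableType dT)
  (M K : nat) (hM : (2 <= M)%N) (hK : (2 <= K)%N)
  (Ptrue : {set {set 'I_M}})
  (hpart : finset.partition Ptrue [set: 'I_M]%SET) (hcard : #|Ptrue| = K)
  (p : 'I_M -> probability T R)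
  (X : 'I_M -> nat -> Omega -> T)
  (hXmeas : forall i l, measurable_fun setT (X i l))
  (hXdist : forall i l (B : set T), measurable B -> P (X i l @^-1` B) = p i B)
  (hXind : mutually_independent P (fun il : 'I_M * nat => X il.1 il.2))
  (k : T -> T -> R) (G : R)
  (hkmeas : measurable_fun setT (fun z : T * T => k z.1 z.2))
  (hkpd : pos_def_kernel k)
  (hkb : forall x y, 0 <= k x y <= G)
  (hdIH : d_I (fun i j => mmd k (p i) (p j)) Ptrue
          < d_H (fun i j => mmd k (p i) (p j)) Ptrue) :
  exists alpha : R, 0 < alpha /\
    forall cl : nat -> Omega -> {set {set 'I_M}},
      (forall n w, slink_output (fun i j => dhat k X i j n w) K (cl n w)) ->
      (forall n (Q : {set {set 'I_M}}), measurable (cl n @^-1` [set Q])) ->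
      forall eps : R, 0 < eps ->
        exists C0 : R, forall C : R, C0 <= C ->
          P (error_event k X cl C Ptrue) = 0%E \/
          (\int[P]_w stop_time k X cl C w
            <= ((1 + eps) * (- ln (fine (P (error_event k X cl C Ptrue)))) / alpha)%:E)%E.
Proof.
have indX := mutually_independent_independent (fun il => hXmeas il.1 il.2) hXind.
have [B B0 kB] : exists2 B, 0 < B & forall x y, `|k x y| <= B.
  have /andP[k0 kG] := hkb point point; exists (G + 1); first lra.
  by move=> x y; have /andP[kxy0 kxyG] := hkb x y; rewrite ger0_norm//; lra.
set d := fun i j => mmd k (p i) (p j) in hdIH *.
have d_ge0 i j : 0 <= d i j by rewrite /d mmdE ?sqrtr_ge0//; split=> //; exists B => z.
have dI0 := d_I_ge0 d Ptrue.
pose eta := (d_H d Ptrue - d_I d Ptrue) / 4.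
have [eta0 separated gap0] :
    [/\ 0 < eta, d_I d Ptrue + 3 * eta < d_H d Ptrue & 0 < d_H d Ptrue - eta].
  by rewrite /eta; split; lra.
rewrite -hcard in hK *.
apply: (slink_seq_exponentially_consistent (d := d) (eta := eta)
  (r := Num.sqrt (4 * B)) (dev := deviation_event p X k eta)) => //.
- by move=> i j n; exact: measurable_dhat.
- by rewrite sqrtr_gt0 mulr_gt0.
- by move=> i j n w; exact: dhat_le.
- by move=> n; exact: measurable_deviation_event.
- by move=> n w; exact: dhat_close.
- exact: (deviation_event_exp_decay hXmeas hXdist indX hkmeas hkpd B0 kB eta0).
Qed.
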